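(* Let $d\ge2$ and let $z_1,\dots,z_n$, with $z_i(t)\in\mathbb{R}^d$, be governed by $$\dot{z}_i = \sum_{j \in \mathcal{N}_i(t)}f_{ij}\left(\left\|\frac{z_j}{\|z_j\|} - \frac{z_i}{\|z_i\|}\right\|\right)\frac{\|z_i\|}{\|z_j\|}(z_j - z_i),\qquad z_i(0)=z_{i0},\quad i=1,\dots,n.$$ Suppose there is no $i$ such that $z_{i0}=0$. Let $t_f$ be such that the solution exists during $[0,t_f)$, and for $t\in[0,t_f)$ let $H(t,z_0)\subset\mathbb{R}^d$ be the convex hull of $\{z_1(t),\dots,z_n(t)\}$ when the initial condition is $z_0=[z_{10}^T,\dots,z_{n0}^T]^T$. Then the solution exists and is unique for all times $t>0$, the set $(H(t,z_0))^n$ is forward invariant, and the set $(\mathbb{R}^d\setminus\{0\})^n$ is forward invariant.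
   Context: $\|\cdot\|$ is the Euclidean norm. Weights: each $f_{ij}:\mathbb{R}\to\mathbb{R}$ is Lipschitz and attains positive values for positive arguments. Time-varying graphs: the node set is $\mathcal{V}=\{1,\dots,n\}$. Each neighborhood $\mathcal{N}_i(t)\subset\mathcal{V}$ is a piecewise constant, right-continuous set-valued function of $t\in\mathbb{R}$; there is $\tau_D>0$ such that for every $i$ consecutive discontinuity times $\tau_{ik}$ of $\mathcal{N}_i$ satisfy $\inf_k(\tau_{i(k+1)}-\tau_{ik})>\tau_D$. The graph is $\mathcal{G}(t)=(\mathcal{V},\mathcal{E}(t))$ with $(i,j)\in\mathcal{E}(t)$ iff $j\in\mathcal{N}_i(t)$. Node $i$ is connected to $j$ if there is a directed path from $i$ to $j$. A directed graph is quasi-strongly connected if there is at least one node to which all other nodes are connected. The union graph is $\mathcal{G}([t_1,t_2))=(\mathcal{V},\bigcup_{t\in[t_1,t_2)}\mathcal{E}(t))$. $\mathcal{G}(t)$ is uniformly quasi-strongly connected if there is $T>0$ such that $\mathcal{G}([t,t+T))$ is quasi-strongly connected for all $t$. Standing assumption: $\mathcal{G}(t)$ is uniformly quasi-strongly connected. Solutions are continuous and satisfy the differential equation except at switching times of the graph; the right-hand side is defined only where all $z_i\neq0$. A set is forward invariant if a state in the set (with all components $z_i$ nonzero, so that the dynamics is defined) at some time implies that the state is in the set for all future times; in particular, forward invariance of $(H(t,z_0))^n$ means that, with $t$ fixed, a solution in $(H(t,z_0))^n$ at time $t$ remains in this fixed set at all times $s\ge t$. *)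

(* Defs.v *)
From HB Require Import structures.
From mathcomp Require Import all_boot all_order all_algebra.
From mathcomp Require Import all_classical all_reals all_analysis.

Set Implicit Arguments.
Unset Strict Implicit.
Unset Printing Implicit Defensive.

Import Order.TTheory GRing.Theory Num.Theory.
Import numFieldNormedType.Exports.

Local Open Scope classical_set_scope.
Local Open Scope ring_scope.

Section Euclidean.
Context {R : realType} {d : nat}.
Implicit Type v : 'rV[R]_d.

(* The library norm `|v| on matrices is the sup norm; it is used here only for
   its topology. *)
Definition enorm v : R := Num.sqrt (\sum_(k < d) v 0 k ^+ 2).

Definition direction v : 'rV[R]_d := (enorm v)^-1 *: v.

Definition convex_hull (A : set 'rV[R]_d) : set 'rV[R]_d :=
  smallest [set C | convex_set C] A.

End Euclidean.

Section SwitchingSignals.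
Context {R : realType} {S : Type}.
Implicit Type g : R -> S.

(* Values of a signal are discrete: continuity at t is local constancy at t. *)
Definition discontinuity_time g : set R :=
  [set t | ~ \forall s \near t, g s = g t].

Definition piecewise_constant g :=
  forall a b : R, finite_set (discontinuity_time g `&` `[a, b]).

Definition right_continuous_signal g :=
  forall t : R, \forall s \near t^'+, g s = g t.

Definition consecutive_discontinuities g (s t : R) :=
  [/\ s < t, discontinuity_time g s, discontinuity_time g t &
      discontinuity_time g `&` `]s, t[ = set0].

(* The infimum is +oo when there are fewer than two discontinuity times. *)
Definition dwell_time_gt g (tauD : R) :=
  (tauD%:E < ereal_inf
     [set (st.2 - st.1)%:E | st in
        [set st : R * R | consecutive_discontinuities g st.1 st.2]])%E.

End SwitchingSignals.

Section Graphs.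
Context {R : realType} {n : nat}.
Implicit Type N : 'I_n -> R -> {set 'I_n}.

Definition edge N (t : R) : rel 'I_n := fun i j => j \in N i t.

Definition union_edge N (t1 t2 : R) : rel 'I_n :=
  fun i j => `[< exists2 t, t1 <= t < t2 & edge N t i j >].

Definition quasi_strongly_connected (e : rel 'I_n) :=
  exists r, forall i, connect e i r.

Definition uniformly_quasi_strongly_connected N :=
  exists2 T : R, 0 < T &
    forall t, quasi_strongly_connected (union_edge N t (t + T)).

Definition switching_time N : set R :=
  [set t | exists i, discontinuity_time (N i) t].

End Graphs.

Section Dynamics.
Context {R : realType} {n d : nat}.
Variables (f : 'I_n -> 'I_n -> R -> R) (N : 'I_n -> R -> {set 'I_n}).

Definition state := 'I_n -> 'rV[R]_d.

Implicit Types (x : state) (y : R -> state) (a : R) (b : \bar R).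

Definition nonvanishing x := forall i, x i != 0.

Definition cartesian_power (A : set 'rV[R]_d) : set state :=
  [set x | forall i, A (x i)].

(* Meaningful only when x is nonvanishing. *)
Definition rhs (t : R) x : state := fun i =>
  \sum_(j in N i t)
    (f i j (enorm (direction (x j) - direction (x i)))
       * (enorm (x i) / enorm (x j))) *: (x j - x i).

Definition time_interval a b : set R := [set t | a <= t /\ (t%:E < b)%E].

(* A continuous curve on [a, b) obeying the differential equation at every
   interior nonswitching time at which the right-hand side is defined.  A
   trajectory is not required to be nonvanishing, so that forward invariance
   of the set of nonvanishing states does not hold by definition. *)
Definition trajectory a b y :=
  (forall i, {within time_interval a b, continuous (fun t => y t i)}) /\
  (forall t, a < t -> (t%:E < b)%E -> ~ switching_time N t ->
     nonvanishing (y t) ->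
     forall i, is_derive t (1 : R) (fun s => y s i) (rhs t (y t) i)).

Definition solution a b y :=
  trajectory a b y /\ (forall t, time_interval a b t -> nonvanishing (y t)).

Definition forward_invariant (A : set state) :=
  forall a b y, 0 <= a -> trajectory a b y ->
    A (y a) -> nonvanishing (y a) ->
    forall t, time_interval a b t -> A (y t).

End Dynamics.

Arguments state : clear implicits.

(* Main.v *)
Require Import Defs.
From HB Require Import structures.
From mathcomp Require Import all_boot all_order all_algebra.
From mathcomp Require Import all_classical all_reals all_analysis.
From mathcomp Require Import measurable_realfun ring lra.

(** The proof rests on a maximum principle for finite families of functions of
    time, [max_principle]: if, off a set of exceptional instants, the largest of
    the functions cannot grow faster than a multiple of itself when it is
    positive, then functions which start nonpositive stay nonpositive.  The
    switching times are allowed as exceptional instants because none of them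
    follows a given time immediately.  The principle is used four times.

    - Norms.  For the agent [i] of smallest norm, the factors
      [enorm (z i) / enorm (z j)] are at most 1 and the weights are bounded by
      some [F], so the squared norm of [z i] decreases at a relative rate of at
      most [4 * n * F].  Hence the norms stay above a decreasing exponential, and no
      component vanishes in finite time ([enorm_lower_bound]).

    - Convex hulls.  The weights are nonnegative, so for every vector [u] the
      maximum over [i] of [dot u (z i)] does not increase
      ([closed_trajectory_dot_le]).  A point which satisfies all the affine
      inequalities valid at finitely many points lies in their convex hull
      ([convex_hull_separation]), which gives the invariance of the hull.

    - Uniqueness.  By the two previous points, trajectories on a bounded interval
      stay in a region where norms are bounded below by some [r] and coordinates
      are bounded by some [B].  There the right-hand side is Lipschitz, uniformly
      in time, and the maximum principle applies to the differences of the
      coordinates of two trajectories ([closed_trajectory_unique]).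

    - Existence.  On an interval [0, T] the right-hand side is replaced by a
      field in which norms are truncated from below at [r] and coordinates are
      clamped to [- B, B].  This field is bounded, globally Lipschitz in the
      state and measurable in time, so it has an integral curve ([picard]).  The
      clamped field does not increase the largest coordinate
      ([regularized_solution_le]), and the lower bound on norms holds for
      truncated norms too; so for suitable [r] and [B] the curve never meets the
      modifications and solves the original equation.  By uniqueness the
      solutions for different [T] agree and define a global one. *)

Import Order.TTheory GRing.Theory Num.Theory.
Import numFieldNormedType.Exports.

Local Open Scope classical_set_scope.
Local Open Scope ring_scope.

(** * Maximum principle *)

(** The epsilon-delta form of continuity on [A] at one of its points. *)
Lemma continuous_within_dist {R : realType} {A : set R} {g : R -> R} {x e : R} :
  {within A, continuous g} -> A x -> 0 < e ->
  exists2 d, 0 < d & forall y, A y -> `|y - x| < d -> `|g y - g x| < e.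
Proof.
move=> cg Ax e0.
have : g @ within A (nbhs x) --> g x.
  by have := cg x; rewrite /continuous_at/= nbhs_subspace_in.
move=> /cvgrPdist_lt /(_ e e0); rewrite near_withinE.
move=> /nbhs_ballP[d /= d0 dP]; exists d => // y Ay yx.
by rewrite distrC; apply: dP => //; rewrite /ball/= distrC.
Qed.

Lemma is_derive_left_max_ge0 {R : realType} (h : R -> R) (s t D : R) :
  s < t -> is_derive t (1 : R) h D -> (forall u, s <= u <= t -> h u <= h t) ->
  0 <= D.
Proof.
move=> st [dh <-] hmax.
rewrite ['D_1 h t]cvg_at_leftE; last exact: dh.
apply: limr_ge.
  rewrite -(cvg_at_leftE (fun u => u^-1 *: ((h \o shift t) _ - h t)))//.
  apply: cvg_trans dh; apply: cvg_app.
  move=> A [e egt0 Ae]; exists e => // x xe xgt0; apply: Ae => //.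
  exact/ltr0_neq0.
near=> u; apply: mulr_le0.
  by rewrite invr_le0; apply: ltW; near: u; exists 1 => /=.
rewrite subr_le0 [_%:A]mulr1; apply: hmax; near: u.
exists (t - s); first by rewrite /= subr_gt0.
move=> u /=; rewrite sub0r normrN => /ltr_normlP[u1 u2] u0.
by apply/andP; split; lra.
Unshelve. all: by end_near. Qed.

(** A finite family of continuous functions on [a, b] attains its maximum, over
    the indices and the times together. *)
Lemma EVT_max_fin {R : realType} {J : finType} (g : J -> R -> R) (a b : R) (j : J) :
  a <= b -> (forall i, {within `[a, b], continuous (g i)}) ->
  exists i t, a <= t <= b /\ forall k s, a <= s <= b -> g k s <= g i t.
Proof.
move=> ab cg.
have /choice[c cP] : forall i, exists c, c \in `[a, b]%R /\
    forall t, t \in `[a, b]%R -> g i t <= g i c.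
  by move=> i; have [c] := EVT_max ab (cg i); exists c.
have [i _ iP] := @Order.TotalTheory.arg_maxP _ _ J j xpredT (fun i => g i (c i)) isT.
exists i, (c i); split; first by have [] := cP i; rewrite in_itv.
move=> k s sab; apply: le_trans (iP k isT).
by have [_] := cP k; apply; rewrite in_itv.
Qed.

Section MaxPrinciple.
Context {R : realType} {J : finType}.
Variables (g : J -> R -> R) (S : set R) (a b K eta : R).
Hypothesis g_cont : forall j, {within `[a, b], continuous (g j)}.
Hypothesis S_right : forall t : R, exists2 e : R, 0 < e & forall s : R, t < s < t + e -> ~ S s.
Hypothesis K_ge0 : 0 <= K.
Hypothesis eta_gt0 : 0 < eta.
Hypothesis g_start : forall j, g j a <= 0.
Hypothesis g_der : forall j t, a < t <= b -> ~ S t ->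
  (forall i, g i t <= g j t) -> 0 < g j t < eta ->
  exists2 D, is_derive t (1 : R) (g j) D & D <= K * g j t.

(** If all [g j] start nonpositive and, off the exceptional set [S], whichever of
    them is the largest is differentiable with [g j' <= K * g j] while it lies in ]0, eta[,
    then all of them stay nonpositive.  Nothing is required of the values above
    [eta], since by continuity the family crosses ]0, eta[ first; points of [S]
    do no harm since each time is followed by an interval free of them. *)
Lemma max_principle j t : a <= t <= b -> g j t <= 0.
Proof.
move=> tab; rewrite leNgt; apply/negP => gt0.
pose A := [set s | a <= s <= b /\ exists i, 0 < g i s].
have At : A t by split=> //; exists j.
have lbA : lbound A a by move=> s [/andP[]].
have hiA : has_inf A by split; [exists t | exists a].
(* the last time up to which all the functions are nonpositive *)
pose T := inf A.
have aT : a <= T by apply: lb_le_inf => //; exists t.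
have Tt : T <= t by apply: ge_inf => //; exists a.
have Tab : `[a, b]%classic T.
  by rewrite /= in_itv/= aT/= (le_trans Tt)//; case/andP: tab.
(* positivity at [T] would persist on the left of [T], inside [A] *)
have gT i : g i T <= 0.
  rewrite leNgt; apply/negP => giT.
  have [d d0 dP] := continuous_within_dist (g_cont i) Tab giT.
  have aT' : a < T.
    by rewrite lt_neqAle aT andbT; apply: contraTneq giT => <-; rewrite -leNgt.
  pose s := Num.max a (T - d / 2).
  have sT : s < T by rewrite gt_max aT'/=; lra.
  have sa : a <= s by rewrite le_max lexx.
  have sd : T - d / 2 <= s by rewrite le_max lexx orbT.
  have sab : `[a, b]%classic s.
    by rewrite /= in_itv/= sa/= (le_trans (ltW sT))//; case/andP: Tab.
  have : `|g i s - g i T| < g i T.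
    by apply: dP => //; rewrite ltr_norml; apply/andP; split; lra.
  rewrite ltr_norml => /andP[gis _].
  have : T <= s.
    by apply: ge_inf; [exists a | split; [|exists i; lra]].
  by rewrite leNgt sT.
have [e e0 eP] := S_right T.
have /choice[d dP] : forall i, exists d : R, 0 < d /\
    forall y, `[a, b]%classic y -> `|y - T| < d -> `|g i y - g i T| < eta.
  move=> i; have [d d0 dP] := continuous_within_dist (g_cont i) Tab eta_gt0.
  by exists d.
have [i0 _ i0P] := @Order.TotalTheory.arg_minP _ _ J j xpredT d isT.
(* between [T] and [T + r] there is no exceptional time, the values are below
   [eta], and [(K + 1) * (t - T) < 1] *)
pose r := Num.min (Num.min e (d i0)) (K + 1)^-1.
have K1 : 0 < K + 1 by rewrite ltr_wpDl.
have r0 : 0 < r by rewrite !lt_min e0 (dP i0).1 invr_gt0 K1.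
have [s [sab [i1 gi1]] sTr] := inf_adherent r0 hiA.
rewrite -/T in sTr.
have Ts : T < s.
  rewrite lt_neqAle ge_inf ?andbT//; [|by exists a|by split=> //; exists i1].
  by apply: contraTneq gi1 => <-; rewrite -leNgt gT.
have sub : `[T, s]%classic `<=` `[a, b]%classic.
  move=> u /=; rewrite !in_itv/= => /andP[Tu us].
  by rewrite (le_trans aT Tu)/= (le_trans us)//; case/andP: sab.
have cg i : {within `[T, s], continuous (g i)}.
  by apply: (continuous_subspaceW sub); exact: g_cont.
have [j0 [t0 [t0T t0max]]] := EVT_max_fin _ _ _ j (ltW Ts) cg.
set m := g j0 t0 in t0max.
have m0 : 0 < m by apply: lt_le_trans gi1 (t0max _ _ _); rewrite ltW//=.
(* Tilting by a slope larger than [K * m] moves the maximum to a point where the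
   derivative exceeds [K * m]; the slope is small enough for the tilted maximum
   to remain positive. *)
pose eps := (K + 1) * m.
pose h i u := g i u - eps * (u - T).
have ch i : {within `[T, s], continuous (h i)}.
  move=> x; apply: cvgB; first exact: cg.
  apply: cvgM; first exact: cvg_cst.
  apply: cvgB; last exact: cvg_cst.
  by apply: (@continuous_subspaceT _ _ _ id) => y; exact: cvg_id.
have [j1 [t1 [t1T t1max]]] := EVT_max_fin _ _ _ j (ltW Ts) ch.
have h0 : 0 < h j1 t1.
  apply: lt_le_trans (t1max j0 t0 t0T).
  rewrite /h -/m /eps subr_gt0 mulrAC gtr_pMl//.
  have : t0 - T < (K + 1)^-1.
    have := sTr; rewrite -ltrBlDl !lt_min => /andP[_]; apply: le_lt_trans.
    by rewrite lerB//; case/andP: t0T.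
  by rewrite -[_^-1]mul1r ltr_pdivlMr// mulrC.
have eps0 : 0 < eps by rewrite mulr_gt0.
have [Tt1 t1s] := andP t1T.
have gj1 : h j1 t1 <= g j1 t1 by rewrite /h lerBlDr lerDl mulr_ge0 ?(ltW eps0)// subr_ge0.
have Tt1' : T < t1.
  rewrite lt_neqAle Tt1 andbT; apply: contraTneq (lt_le_trans h0 gj1) => <-.
  by rewrite -leNgt gT.
have st1 : s - T < r by rewrite ltrBlDl.
have [se sd sK] : [/\ s - T < e, s - T < d i0 & s - T < (K + 1)^-1].
  by move: st1; rewrite !lt_min => /andP[/andP[-> ->] ->].
have nS : ~ S t1 by apply: eP; apply/andP; split; lra.
have t1ab : a < t1 <= b.
  have /andP[_ sb] := sab.
  by apply/andP; split; [lra | exact: le_trans t1s sb].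
have gmax i : g i t1 <= g j1 t1.
  by have := t1max i t1 t1T; rewrite /h lerD2r.
have geta : 0 < g j1 t1 < eta.
  rewrite (lt_le_trans h0 gj1)/=.
  have : `|g j1 t1 - g j1 T| < eta.
    apply: (dP j1).2.
      by rewrite /= in_itv/=; have /andP[/ltW -> ->] := t1ab.
    rewrite ger0_norm ?subr_ge0//; apply: lt_le_trans (i0P j1 isT); lra.
  by rewrite ltr_norml => /andP[_]; have := gT j1; lra.
have [D dD DK] := g_der _ _ t1ab nS gmax geta.
have dh : is_derive t1 (1 : R) (h j1) (D - eps).
  have : is_derive t1 (1 : R) (fun u => eps * (u - T)) eps.
    apply: is_derive_eq; rewrite subr0 ?scaler0 ?add0r.
    by rewrite /GRing.scale/= mulr1.
  by move=> H; exact: is_deriveB.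
have : 0 <= D - eps.
  apply: (is_derive_left_max_ge0 _ _ _ _ Tt1' dh) => u /andP[Tu ut].
  by apply: t1max; rewrite Tu/= (le_trans ut).
have : K * g j1 t1 <= K * m by rewrite ler_wpM2l// t0max.
rewrite /eps mulrDl mul1r; lra.
Qed.

End MaxPrinciple.

(** * Euclidean geometry of row vectors *)

Section EuclideanNorm.
Context {R : realType} {d : nat}.
Implicit Types (u v w : 'rV[R]_d) (a r : R).

(** The Euclidean inner product. *)
Definition dot u v : R := \sum_(k < d) u 0 k * v 0 k.

Lemma dotC u v : dot u v = dot v u.
Proof. by apply: eq_bigr => k _; rewrite mulrC. Qed.

Lemma dotDr u v w : dot u (v + w) = dot u v + dot u w.
Proof.
by rewrite /dot -big_split; apply: eq_bigr => k _; rewrite mxE mulrDr.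
Qed.

Lemma dotZr u a v : dot u (a *: v) = a * dot u v.
Proof. by rewrite /dot mulr_sumr; apply: eq_bigr => k _; rewrite mxE mulrCA. Qed.

Lemma dotBr u v w : dot u (v - w) = dot u v - dot u w.
Proof. by rewrite dotDr -scaleN1r dotZr mulN1r. Qed.

Lemma dot0r u : dot u 0 = 0.
Proof. by rewrite -(scale0r 0) dotZr mul0r. Qed.

Lemma dot_sumr u (I : Type) (s : seq I) (P : pred I) (F : I -> 'rV[R]_d) :
  dot u (\sum_(i <- s | P i) F i) = \sum_(i <- s | P i) dot u (F i).
Proof. by apply: (big_morph (dot u)) => [v w|]; [exact: dotDr | exact: dot0r]. Qed.

Lemma dot_ge0 u : 0 <= dot u u.
Proof. by apply: sumr_ge0 => k _; rewrite -expr2 sqr_ge0. Qed.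

Lemma enorm_ge0 u : 0 <= enorm u.
Proof. exact: sqrtr_ge0. Qed.

Lemma sqr_enorm u : enorm u ^+ 2 = dot u u.
Proof.
rewrite /enorm sqr_sqrtr; last by apply: sumr_ge0 => k _; rewrite sqr_ge0.
by apply: eq_bigr => k _; rewrite expr2.
Qed.

Lemma enormE u : enorm u = Num.sqrt (dot u u).
Proof. by rewrite -sqr_enorm sqrtr_sqr ger0_norm// enorm_ge0. Qed.

Lemma coord_le_enorm u k : `|u 0 k| <= enorm u.
Proof.
rewrite -sqrtr_sqr enormE ler_sqrt; last exact: dot_ge0.
rewrite /dot (bigD1 k)//= -expr2 lerDl.
by apply: sumr_ge0 => j _; rewrite -expr2 sqr_ge0.
Qed.

Lemma enorm_gt0 u : (0 < enorm u) = (u != 0).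
Proof.
rewrite lt_neqAle enorm_ge0 andbT; congr (~~ _).
apply/eqP/eqP => [u0|->]; last by rewrite enormE dot0r sqrtr0.
apply/rowP => k; rewrite mxE; apply/eqP; rewrite -normr_le0.
by rewrite u0 coord_le_enorm.
Qed.

Lemma enormZ a u : enorm (a *: u) = `|a| * enorm u.
Proof.
rewrite !enormE dotZr dotC dotZr mulrA -expr2 sqrtrM ?sqr_ge0//.
by rewrite sqrtr_sqr.
Qed.

Lemma enormN u : enorm (- u) = enorm u.
Proof. by rewrite -scaleN1r enormZ normrN1 mul1r. Qed.

(** The Cauchy-Schwarz inequality. *)
Lemma dot_le_enorm u v : dot u v <= enorm u * enorm v.
Proof.
have [->|u0] := eqVneq u 0.
  by rewrite dotC dot0r mulr_ge0 ?enorm_ge0.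
have [->|v0] := eqVneq v 0.
  by rewrite dot0r mulr_ge0 ?enorm_ge0.
rewrite -!enorm_gt0 in u0 v0.
have := dot_ge0 (enorm v *: u - enorm u *: v).
rewrite dotBr !dotZr [dot _ u]dotC [dot _ v]dotC !dotBr !dotZr -!sqr_enorm.
rewrite [dot v u]dotC => H.
rewrite -subr_ge0 -(pmulr_rge0 _ (mulr_gt0 u0 v0)); lra.
Qed.

Lemma dot_ge_enorm u v : - (enorm u * enorm v) <= dot u v.
Proof.
rewrite lerNl -mulN1r -dotZr scaleN1r -(enormN v); exact: dot_le_enorm.
Qed.

Lemma ler_enormD u v : enorm (u + v) <= enorm u + enorm v.
Proof.
rewrite -ler_sqr ?nnegrE ?addr_ge0 ?enorm_ge0//.
rewrite sqrrD !sqr_enorm dotDr [dot _ u]dotC [dot _ v]dotC !dotDr.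
rewrite [dot v u]dotC; have := dot_le_enorm u v; lra.
Qed.

Lemma ler_dist_enorm u v : `|enorm u - enorm v| <= enorm (u - v).
Proof.
have H (p q : 'rV[R]_d) : enorm p - enorm q <= enorm (p - q).
  by have := ler_enormD (p - q) q; rewrite subrK lerBlDr.
apply/ler_normlP; split; last exact: H.
by have := H v u; rewrite -[enorm (v - u)]enormN !opprB.
Qed.

Lemma enorm_le_sum u : enorm u <= \sum_(k < d) `|u 0 k|.
Proof.
have H (s : seq 'I_d) : \sum_(k <- s) u 0 k ^+ 2 <= (\sum_(k <- s) `|u 0 k|) ^+ 2.
  elim: s => [|k s IH]; first by rewrite !big_nil expr0n.
  rewrite !big_cons sqrrD real_normK ?num_real//.
  have : 0 <= `|u 0 k| * (\sum_(j <- s) `|u 0 j|) by rewrite mulr_ge0// sumr_ge0.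
  by move=> ?; lra.
have s0 : 0 <= \sum_(k < d) `|u 0 k| by rewrite sumr_ge0.
rewrite -[leRHS]ger0_norm// -sqrtr_sqr; apply: ler_wsqrtr; exact: H.
Qed.

(** The norm replaced by [r] where it is smaller, so that for [0 < r] it can be
    inverted on the whole space. *)
Definition trunc_enorm r v : R := Num.max (enorm v) r.

(** The vector [v] divided by its truncated norm. *)
Definition trunc_direction r v : 'rV[R]_d := (trunc_enorm r v)^-1 *: v.

Lemma trunc_enorm_id r v : r <= enorm v -> trunc_enorm r v = enorm v.
Proof. exact: max_l. Qed.

Lemma trunc_enorm_ge0 r v : 0 <= trunc_enorm r v.
Proof. by rewrite le_max enorm_ge0. Qed.

Lemma enorm_trunc_direction r v : enorm (trunc_direction r v) <= 1.
Proof.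
rewrite enormZ normfV ger0_norm ?trunc_enorm_ge0//.
have [->|] := eqVneq (trunc_enorm r v) 0; first by rewrite invr0 mul0r.
move=> t0; have {}t0 : 0 < trunc_enorm r v by rewrite lt_neqAle eq_sym t0 trunc_enorm_ge0.
by rewrite ler_pdivrMl// mulr1 le_max lexx.
Qed.

Lemma enorm_trunc_directionB r u v :
  enorm (trunc_direction r u - trunc_direction r v) <= 2.
Proof.
apply: (le_trans (ler_enormD _ _)); rewrite enormN.
have := enorm_trunc_direction r u; have := enorm_trunc_direction r v; lra.
Qed.

End EuclideanNorm.

Section Derivatives.
Context {R : realType} {d : nat}.

Lemma is_derive_coord (y : R -> 'rV[R]_d) (t : R) D k :
  is_derive t (1 : R) y D -> is_derive t (1 : R) (fun s => y s 0 k) (D 0 k).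
Proof.
move=> [dy <-]; have := (derivable_mxP y t 1).1 dy 0 k => dk.
by apply: DeriveDef => //; rewrite (derive_mx dy) mxE.
Qed.

Lemma is_derive_rV (y : R -> 'rV[R]_d) (t : R) (D : 'rV[R]_d) :
  (forall k, is_derive t (1 : R) (fun s => y s 0 k) (D 0 k)) ->
  is_derive t (1 : R) y D.
Proof.
move=> H; have dy : derivable y t 1.
  by apply/derivable_mxP => i k; rewrite ord1; have [] := H k.
apply: DeriveDef => //; rewrite (derive_mx dy); apply/rowP => k.
by rewrite mxE; have [] := H k.
Qed.

Lemma is_derive_dot (w : 'rV[R]_d) (y : R -> 'rV[R]_d) (t : R) D :
  is_derive t (1 : R) y D -> is_derive t (1 : R) (fun s => dot w (y s)) (dot w D).
Proof.
move=> dy; rewrite /dot.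
have -> : (fun s => \sum_(k < d) w 0 k * y s 0 k) =
    \sum_(k < d) (w 0 k *: (fun s => y s 0 k)).
  by apply/funext => s; rewrite fct_sumE.
apply: is_derive_eq.
  by apply: is_derive_sum => k; apply: is_deriveZ; exact: is_derive_coord.
by [].
Qed.

Lemma is_derive_dot_self (y : R -> 'rV[R]_d) (t : R) D :
  is_derive t (1 : R) y D ->
  is_derive t (1 : R) (fun s => dot (y s) (y s)) (2 * dot (y t) D).
Proof.
move=> dy; rewrite /dot.
have -> : (fun s => \sum_(k < d) y s 0 k * y s 0 k) =
    \sum_(k < d) ((fun s => y s 0 k) * (fun s => y s 0 k)).
  by apply/funext => s; rewrite fct_sumE.
apply: is_derive_eq.
  by apply: is_derive_sum => k; apply: is_deriveM; exact: is_derive_coord.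
rewrite mulr_sumr; apply: eq_bigr => k _.
by rewrite /GRing.scale/=; ring.
Qed.

Lemma within_continuous_coord (A : set R) (y : R -> 'rV[R]_d) k :
  {within A, continuous y} -> {within A, continuous (fun t => y t 0 k)}.
Proof.
move=> cy x; apply: (@cvg_comp _ _ _ y (fun M : 'rV[R]_d => M 0 k)).
  exact: cy.
exact: coord_continuous.
Qed.

Lemma continuous_sum {T : topologicalType} n (h : 'I_n -> T -> R) :
  (forall k, continuous (h k)) -> continuous (fun t => \sum_(k < n) h k t).
Proof.
move=> ch; elim: (index_enum _) => [|k s IH] x.
  by under eq_fun do rewrite big_nil; exact: cvg_cst.
by under eq_fun do rewrite big_cons; apply: cvgD; [exact: ch | exact: IH].
Qed.

Lemma within_continuous_dot (A : set R) (y z : R -> 'rV[R]_d) :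
  {within A, continuous y} -> {within A, continuous z} ->
  {within A, continuous (fun t => dot (y t) (z t))}.
Proof.
move=> cy cz; apply: (@continuous_sum (subspace A)) => k x.
by apply: cvgM; exact: within_continuous_coord.
Qed.

End Derivatives.

Lemma continuous_rV {R : realType} {T : topologicalType} {d : nat} (y : T -> 'rV[R]_d) :
  (forall k, continuous (fun t => y t 0 k)) -> continuous y.
Proof.
move=> cy t; apply/cvg_ballP => e e0.
have H : \forall s \near t, forall k, ball (y t 0 k) e (y s 0 k).
  apply: (@filter_forall T _ (fun k s => ball (y t 0 k) e (y s 0 k)) (nbhs t)) => k.
  by have /cvg_ballP/(_ e e0) := cy k t.
by apply: filterS H => s H; split=> // i k; rewrite ord1; exact: H.
Qed.

(** * Convex hulls of finite families *)

Section ConvexHull.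
Context {R : realType} {d : nat}.

Lemma dot_subZ (u v : 'rV[R]_d) s :
  dot (u - s *: v) (u - s *: v) = dot u u - 2 * s * dot u v + s ^+ 2 * dot v v.
Proof.
rewrite dotBr [dot _ u]dotC [dot _ (s *: v)]dotC !dotBr !dotZr.
rewrite [dot (s *: v) u]dotC [dot (s *: v) v]dotC !dotZr; ring.
Qed.

Lemma convex_setE (A : set 'rV[R]_d) : convex_set A <->
  forall x y (s : R), A x -> A y -> 0 <= s -> s <= 1 -> A (s *: x + (1 - s) *: y).
Proof.
split=> [cA x y s Ax Ay s0 s1|cA x y l /set_mem Ax /set_mem Ay].
  by have := cA x y (Itv01 s0 s1); rewrite !inE; apply.
by rewrite inE; exact: cA.
Qed.

(** A convex set contains the weighted means of its points; the weights are
    normalized so that the induction on [s] applies to partial sums. *)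
Lemma convex_set_sum (A : set 'rV[R]_d) (I : Type) (s : seq I) (l : I -> R)
    (p : I -> 'rV[R]_d) :
  convex_set A -> (forall i, A (p i)) -> (forall i, 0 <= l i) ->
  0 < \sum_(i <- s) l i ->
  A ((\sum_(i <- s) l i)^-1 *: \sum_(i <- s) l i *: p i).
Proof.
move=> /convex_setE cA Ap l0; elim: s => [|i s IH]; first by rewrite big_nil ltxx.
rewrite !big_cons; set a := \sum_(i <- s) l i; set v := \sum_(i <- s) _.
have a0 : 0 <= a by exact: sumr_ge0.
move=> la0; move: IH; rewrite -/a -/v.
move: (a0); rewrite le_eqVlt => /predU1P[a0' _|a0' /(_ a0') Av].
  (* the total weight of the tail vanishes: the mean is [p i] *)
  have l00 j : (j \in [seq l j | j <- s]) -> j = 0.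
    move=> js; apply/eqP; rewrite eq_le.
    have /allP /(_ _ js) -> : all (>= 0) [seq l j | j <- s].
      by elim: (s) => //= k r ->; rewrite l0.
    rewrite andbT a0' /a -(big_map l xpredT id).
    elim: {a v la0 a0 a0'} (s) js => //= k r IH.
    rewrite inE big_cons => /predU1P[->|/IH]; first by rewrite lerDl big_map sumr_ge0.
    by move=> /le_trans; apply; rewrite lerDr.
  have v0 : v = 0.
    rewrite /v; elim: {a v la0 a0 a0'} (s) l00 => [|k r IH] H; first by rewrite big_nil.
    rewrite big_cons IH ?addr0; last by move=> j jr; apply: H; rewrite inE jr orbT.
    by rewrite (H (l k)) ?scale0r// inE eqxx.
  move: la0; rewrite -a0' v0 !addr0 => li0.
  by rewrite scalerA mulVf ?scale1r// gt_eqF.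
have := cA (p i) (a^-1 *: v) (l i / (l i + a)) (Ap i) Av.
have -> : 1 - l i / (l i + a) = a / (l i + a).
  by field; rewrite gt_eqF.
rewrite scalerDr !scalerA.
have -> : a / (l i + a) * a^-1 = (l i + a)^-1 by field; rewrite !gt_eqF.
rewrite mulrC; apply.
  by rewrite mulr_ge0// invr_ge0 addr_ge0.
by rewrite mulrC ler_pdivrMr// mul1r lerDl.
Qed.

(** The standard simplex, as the set of barycentric coordinates. *)
Definition simplex n : set 'rV[R]_n :=
  [set l | (forall j, `[0, 1]%classic (l ord0 j)) /\ \sum_j l ord0 j = 1].

Lemma simplex_compact n : compact (simplex n).
Proof.
pose B := [set l : 'rV[R]_n | forall j, `[0, 1]%classic (l ord0 j)].
have cB : compact B.
  by apply: (@rV_compact R n (fun=> `[0, 1]%classic)) => _; exact: segment_compact.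
have cS : closed ((fun l : 'rV[R]_n => \sum_j l ord0 j) @^-1` [set x | x = 1]).
  apply: preimage_closed; last exact: closed_eq.
  by move=> l _; apply: continuous_sum => j; exact: coord_continuous.
apply: (subclosed_compact _ cB); last by move=> l [].
have cB' : closed B by apply: compact_closed => //; exact: norm_hausdorff.
exact: closedI cB' cS.
Qed.

(** A point which satisfies every affine inequality valid at the points [p i]
    lies in their convex hull.  The point of the hull nearest to [q] exists by
    compactness of the simplex; were it different from [q], the direction from
    it to [q] would give a violated inequality. *)
Lemma convex_hull_separation n (p : 'I_n -> 'rV[R]_d) (q : 'rV[R]_d) :
  (forall u m, (forall i, dot u (p i) <= m) -> dot u q <= m) ->
  convex_hull [set p i | i in [set: 'I_n]] q.
Proof.
move=> Hq.
have [n0|n0] := posnP n.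
  have := Hq 0 (-1); rewrite dotC dot0r => H.
  have : (0 : R) <= -1 by apply: H => i; have := ltn_ord i; rewrite [in X in (_ < X)%N]n0.
  by rewrite lerNr oppr0 ler10.
pose h (l : 'rV[R]_n) := \sum_j l ord0 j *: p j.
pose phi (l : 'rV[R]_n) := dot (q - h l) (q - h l).
have cphi : continuous phi.
  have ch k : continuous (fun l => (q - h l) 0 k).
    have -> : (fun l => (q - h l) 0 k) = (fun l => q 0 k - \sum_j l ord0 j * p j 0 k).
      apply/funext => l; rewrite !mxE /h summxE; congr (_ - _).
      by apply: eq_bigr => j _; rewrite mxE.
    have cs : continuous (fun l : 'rV[R]_n => \sum_j l ord0 j * p j 0 k).
      apply: continuous_sum => j l.
      have c1 := @coord_continuous R 1 n ord0 j l.
      exact: (continuousM c1 (@cst_continuous 'rV[R]_n R (p j 0 k) l)).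
    by move=> l; exact: (continuousB (@cst_continuous 'rV[R]_n R (q 0 k) l) (cs l)).
  apply: (@continuous_sum R _ d (fun k l => (q - h l) 0 k * (q - h l) 0 k)) => k l.
  exact: (continuousM (ch k l) (ch k l)).
have s0 : simplex n !=set0.
  exists (delta_mx 0 (Ordinal n0)); split=> [j|].
    by rewrite /= in_itv/= mxE eqxx/=; case: eqP => _; rewrite ?lexx ler01.
  rewrite (bigD1 (Ordinal n0))//= mxE !eqxx/= big1 ?addr0// => j jn.
  by rewrite mxE (negbTE jn) andbF.
have [l /set_mem[l01 l1] lmin] :=
  EVT_min_rV s0 (simplex_compact n) (continuous_subspaceT cphi).
have l0 j : 0 <= l ord0 j by have := l01 j; rewrite /= in_itv/= => /andP[].
have hl A : convex_set A -> [set p i | i in [set: 'I_n]] `<=` A -> A (h l).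
  move=> cA pA; have := convex_set_sum A 'I_n (index_enum _) (l ord0) p cA.
  by rewrite l1 invr1 scale1r; apply => // i; apply: pA; exists i.
(* the nearest point [h l] satisfies the variational inequality *)
set D := q - h l.
have HD j : dot D (p j) <= dot D (h l).
  rewrite leNgt; apply/negP => jD.
  pose v := p j - h l.
  have Dv : 0 < dot D v by rewrite /v dotBr subr_gt0.
  have Hs s : 0 <= s -> s <= 1 -> 2 * s * dot D v <= s ^+ 2 * dot v v.
    move=> s0' s1.
    (* move from the nearest point towards the vertex [j] *)
    pose m : 'rV[R]_n := s *: delta_mx 0 j + (1 - s) *: l.
    have mE k : m ord0 k = s * (k == j)%:R + (1 - s) * l ord0 k.
      by rewrite !mxE eqxx/=.
    have hm : h m = h l + s *: v.
      rewrite /h; under eq_bigr => k _ do rewrite mE scalerDl -!scalerA.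
      rewrite big_split/= -!scaler_sumr -/(h l) (bigD1 j)//= eqxx scale1r.
      rewrite big1 ?addr0; last by move=> k /negbTE ->; rewrite scale0r.
      by rewrite /v scalerBr scalerBl scale1r; rewrite addrCA addrA.
    have ms : simplex n m.
      have m0 k : 0 <= m ord0 k.
        by rewrite mE addr_ge0// mulr_ge0// subr_ge0.
      have m1 : \sum_k m ord0 k = 1.
        under eq_bigr => k _ do rewrite mE.
        rewrite big_split/= -!mulr_sumr l1 (bigD1 j)//= eqxx big1 ?addr0.
          by rewrite mulr1 mulr1 addrCA subrr addr0.
        by move=> k /negbTE ->.
      split=> // k; rewrite /= in_itv/= m0/= -m1 (bigD1 k)//= lerDl.
      by apply: sumr_ge0 => i _.
    have := lmin m (mem_set ms); rewrite /phi hm opprD addrA -/D.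
    rewrite dot_subZ; lra.
  have v0 : 0 <= dot v v := dot_ge0 v.
  (* the step minimizing the distance, shortened so as to be at most 1 *)
  pose s := dot D v / (dot D v + dot v v).
  have t0 : 0 < dot D v + dot v v by rewrite ltr_wpDr.
  have s0' : 0 < s by rewrite divr_gt0.
  have s1 : s <= 1 by rewrite ler_pdivrMr// mul1r lerDl.
  have := Hs s (ltW s0') s1.
  have -> : 2 * s * dot D v = s * (2 * dot D v) by ring.
  rewrite expr2 -mulrA ler_pM2l//.
  have : s * dot v v <= dot D v.
    by rewrite /s mulrAC ler_pdivrMr// ler_pM2l// lerDr ltW.
  lra.
have qh : q = h l.
  apply/eqP; rewrite -subr_eq0 -/D -[_ == _]negbK -enorm_gt0 -leNgt.
  rewrite -(@ler_pXn2r _ 2) ?nnegrE ?enorm_ge0// sqr_enorm expr0n/=.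
  by rewrite {2}/D dotBr subr_le0; exact: Hq.
by rewrite qh => A [cA pA]; exact: hl.
Qed.

Lemma dot_convex_hull_le (A : set 'rV[R]_d) u m q :
  (forall p, A p -> dot u p <= m) -> convex_hull A q -> dot u q <= m.
Proof.
move=> Am /(_ [set x | dot u x <= m]); apply; split; last exact: Am.
apply/convex_setE => x y s /= xm ym s0 s1.
rewrite dotDr !dotZr; have := ler_wpM2l s0 xm.
have s10 : 0 <= 1 - s by rewrite subr_ge0.
have := ler_wpM2l s10 ym; lra.
Qed.

End ConvexHull.

(** * Integrals with exponential weights and geometric sequences *)

Section IntegralBounds.
Context {R : realType}.
Notation mu := (@lebesgue_measure R).
Implicit Types h : R -> R.

Lemma bounded_integrable_itv h (M : R) (i : interval R) :
  (mu [set` i] < +oo)%E -> measurable_fun [set: R] h -> (forall s, `|h s| <= M) ->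
  mu.-integrable [set` i] (EFin \o h).
Proof.
move=> mui mh hM; apply: measurable_bounded_integrable => //.
  exact: measurable_funTS.
exists M; split; first by rewrite num_real.
by move=> x Mx s _ /=; exact: le_trans (hM s) (ltW Mx).
Qed.

Lemma mu_itvcc_fin (a b : R) : (mu `[a, b]%classic < +oo)%E.
Proof. by rewrite lebesgue_measure_itv/=; case: ifP => // _; rewrite -EFinD ltry. Qed.

Lemma mu_itvoc_fin (a b : R) : (mu `]a, b]%classic < +oo)%E.
Proof. by rewrite lebesgue_measure_itv/=; case: ifP => // _; rewrite -EFinD ltry. Qed.

Lemma Rintegral_lt0 h (t : R) : t < 0 -> \int[mu]_(u in `[0, t]) h u = 0.
Proof. by move=> t0; rewrite set_itv_ge ?Rintegral_set0// bnd_simp -ltNge. Qed.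

Lemma Rintegral_lipschitz h (M : R) (s t : R) :
  measurable_fun [set: R] h -> (forall s, `|h s| <= M) ->
  `|(\int[mu]_(u in `[0, t]) h u) - (\int[mu]_(u in `[0, s]) h u)| <= M * `|t - s|.
Proof.
move=> mh hM.
have M0 : 0 <= M := le_trans (normr_ge0 _) (hM 0).
have intcc a b : mu.-integrable `[a, b] (EFin \o h).
  by apply: (bounded_integrable_itv h M) => //; exact: mu_itvcc_fin.
have bound (i : interval R) : (mu [set` i] < +oo)%E ->
    `|\int[mu]_(u in [set` i]) h u| <= M * fine (mu [set` i]).
  move=> mui; have inti := bounded_integrable_itv h M i mui mh hM.
  apply: (le_trans (le_normr_Rintegral _ inti)) => //.
  rewrite -Rintegral_cst//; apply: le_Rintegral => //.
    by have := integrable_norm inti; apply: eq_integrable.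
  by apply: (bounded_integrable_itv (cst M) M) => // u; rewrite ger0_norm.
wlog st : s t / s <= t.
  move=> H; have [/H//|/ltW/H] := leP s t.
  by rewrite distrC [`|s - t|]distrC.
have [t0|t0] := ltP t 0.
  by rewrite !Rintegral_lt0 ?(le_lt_trans st)// subrr normr0 mulr_ge0.
have [s0|s0] := ltP s 0.
  rewrite (Rintegral_lt0 _ s)// subr0.
  apply: (le_trans (bound _ (mu_itvcc_fin _ _))).
  rewrite ler_wpM2l// lebesgue_measure_itv/= lte_fin ger0_norm ?subr_ge0//.
  by case: ifP => _ /=; rewrite ?subr0 ?subr_ge0// lerBrDr gerDl ltW.
rewrite (Rintegral_itvB (intcc 0 t)) ?bnd_simp//.
apply: (le_trans (bound _ (mu_itvoc_fin _ _))).
rewrite ler_wpM2l// lebesgue_measure_itv/= lte_fin ger0_norm ?subr_ge0//.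
by case: ifP => _ //=; rewrite subr_ge0.
Qed.

Lemma Rintegral_expR_le (k t : R) : 0 < k -> 0 <= t ->
  \int[mu]_(u in `[0, t]) (k * expR (k * u)) <= expR (k * t).
Proof.
move=> k0; rewrite le_eqVlt => /predU1P[<-|t0].
  by rewrite set_itv1 Rintegral_set1 expR_ge0.
have dF (x : R) : is_derive x (1 : R) (fun u => expR (k * u)) (k * expR (k * x)).
  have d1 : is_derive x (1 : R) (fun u : R => k * u) k.
    by apply: is_derive_eq; rewrite /GRing.scale/= mulr1.
  have := is_derive1_comp (f := expR) (is_derive_expR _) d1.
  by move=> /is_derive_eq; apply; rewrite /GRing.scale/= mulrC.
have cF : continuous (fun u => expR (k * u)).
  move=> x; apply/differentiable_continuous/derivable1_diffP.
  by have [] := dF x.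
rewrite /Rintegral (@continuous_FTC2 _ _ (fun u => expR (k * u)))//=.
- by rewrite mulr0 expR0 gerBl.
- apply: continuous_subspaceT => x.
  exact: (continuousM (@cst_continuous R R k x) (cF x)).
- split; first by move=> x _; have [] := dF x.
    exact: cvg_at_right_filter (cF _).
  exact: cvg_at_left_filter (cF _).
- by move=> x _; rewrite derive1E; have [_ ->] := dF x.
Qed.

(** In the weighted norm [sup `|h t| * expR (- k * t)] over [0 <= t], integration
    from 0 divides the size by [k]. *)
Lemma Rintegral_weighted_le h (M A k t : R) : 0 < k -> 0 <= A ->
  measurable_fun [set: R] h -> (forall s, `|h s| <= M) ->
  (forall s, 0 <= s -> `|h s| <= A * expR (k * s)) ->
  `|\int[mu]_(u in `[0, t]) h u| <= A / k * expR (k * t).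
Proof.
move=> k0 A0 mh hM hA.
have [t0|t0] := ltP t 0.
  rewrite Rintegral_lt0// normr0.
  by rewrite mulr_ge0 ?expR_ge0// divr_ge0// ltW.
have inth := bounded_integrable_itv h M `[0, t] (mu_itvcc_fin _ _) mh hM.
have ck (c : R) : continuous (fun u => c * expR (k * u)).
  move=> x; apply: (continuousM (@cst_continuous R R c x)).
  apply: (@continuous_comp _ _ _ (fun u => k * u) expR); last exact: continuous_expR.
  exact: (continuousM (@cst_continuous R R k x) (@cvg_id _ (nbhs x))).
have intk c : mu.-integrable `[0, t] (EFin \o (fun u => c * expR (k * u))).
  apply: continuous_compact_integrable; first exact: segment_compact.
  exact: continuous_subspaceT.
apply: (le_trans (le_normr_Rintegral _ inth)) => //.
apply: (@le_trans _ _ (\int[mu]_(u in `[0, t]) (A / k * (k * expR (k * u))))).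
  apply: le_Rintegral => //.
  - by have := integrable_norm inth; apply: eq_integrable.
  - have := intk A; apply: eq_integrable => // u _ /=; congr EFin.
    by rewrite mulrA divfK// gt_eqF.
  - move=> u; rewrite /= in_itv/= => /andP[u0 _].
    by rewrite mulrA divfK ?gt_eqF// hA.
rewrite RintegralZl//.
by rewrite ler_wpM2l ?divr_ge0 ?(ltW k0)// Rintegral_expR_le.
Qed.

End IntegralBounds.

Lemma geometric_small {R : realType} (B e : R) : 0 < e ->
  exists k : nat, B * 2^-1 ^+ k <= e.
Proof.
move=> e0; pose k := Num.bound `|B / e|; exists k.
have h2 : 0 < (2 : R) ^+ k by rewrite exprn_gt0.
rewrite exprVn ler_pdivrMr// mulrC -ler_pdivrMr//.
apply: (le_trans (ler_norm _)); apply: (le_trans (ltW (archi_boundP _))) => //.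
by rewrite -natrX ler_nat ltnW// ltn_expl.
Qed.

(** A sequence with geometrically decreasing steps stays at the distance of the
    remaining steps from its limit; the limit is the supremum of the
    nondecreasing sequence [u k - 2 * B * 2^-1 ^+ k]. *)
Lemma geometric_limit {R : realType} (u : nat -> R) (B : R) :
  (forall k, `|u k.+1 - u k| <= B * 2^-1 ^+ k) ->
  exists l, forall k, `|l - u k| <= 2 * B * 2^-1 ^+ k.
Proof.
move=> H.
have B0 : 0 <= B by have := le_trans (normr_ge0 _) (H 0); rewrite expr0 mulr1.
pose w k := 2 * B * 2^-1 ^+ k.
have w0 k : 0 <= w k by rewrite mulr_ge0 ?exprn_ge0 ?mulr_ge0 ?invr_ge0.
have Hw k : - (w k - w k.+1) <= u k.+1 - u k <= w k - w k.+1.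
  have -> : w k - w k.+1 = B * 2^-1 ^+ k by rewrite /w exprS; field.
  by rewrite -ler_norml H.
have lower k m : u k - w k <= u (k + m)%N - w (k + m)%N.
  elim: m => [|m IH]; first by rewrite addn0.
  by rewrite addnS; have /andP[] := Hw (k + m)%N; move: IH; lra.
have upper k m : u (k + m)%N + w (k + m)%N <= u k + w k.
  elim: m => [|m IH]; first by rewrite addn0.
  by rewrite addnS; have /andP[] := Hw (k + m)%N; move: IH; lra.
have cross k m : u k - w k <= u m + w m.
  have := lower k m; have := upper m k; rewrite addnC; have := w0 (k + m)%N; lra.
pose A := [set u k - w k | k in [set: nat]].
have hA : has_sup A.
  split; first by exists (u 0%N - w 0%N); exists 0%N.
  by exists (u 0%N + w 0%N) => _ [k _ <-]; exact: cross.
exists (sup A) => k; rewrite -/(w k) ler_norml; apply/andP; split.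
  by rewrite lerBrDl; apply: ub_le_sup; [case: hA|exists k].
rewrite lerBlDl; apply: ge_sup; first by case: hA.
by move=> _ [m _ <-]; exact: cross.
Qed.

(** * Picard iteration *)

Section Picard.
Context {R : realType} {I : Type}.
Variables (G : R -> (I -> R) -> I -> R) (S : set R) (M L : R) (x0 : I -> R).
Notation mu := (@lebesgue_measure R).
Implicit Types x y : R -> I -> R.

Hypothesis L_gt0 : 0 < L.
Hypothesis G_bound : forall t u p, `|G t u p| <= M.
Hypothesis G_lip : forall t (u v : I -> R) e, (forall p, `|u p - v p| <= e) ->
  forall p, `|G t u p - G t v p| <= L * e.
Hypothesis G_meas : forall x, (forall p, continuous (fun t => x t p)) ->
  forall p, measurable_fun [set: R] (fun t => G t (x t) p).
Hypothesis G_cont : forall x, (forall p, continuous (fun t => x t p)) ->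
  forall p t, ~ S t -> {for t, continuous (fun s => G s (x s) p)}.

(** The integral operator whose fixed points are the integral curves of [G]
    from [x0].  Before time 0 the interval of integration is empty. *)
Definition picard_map x : R -> I -> R :=
  fun t p => x0 p + \int[mu]_(s in `[0, t]) G s (x s) p.

(** The Picard iterates of the constant curve [x0]. *)
Definition picard_iter (k : nat) : R -> I -> R :=
  iter k picard_map (fun=> x0).

Let M0 : I -> 0 <= M.
Proof. by move=> p; exact: le_trans (normr_ge0 _) (G_bound 0 x0 p). Qed.

Lemma lipschitz_dist_continuous (h : R -> R) K :
  (forall s t, `|h t - h s| <= K * `|t - s|) -> continuous h.
Proof.
move=> hK t; apply/cvgrPdist_le => e e0.
have K1 : 0 < `|K| + 1 by rewrite ltr_wpDl.
exists (e / (`|K| + 1)) => /=; first by rewrite divr_gt0.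
move=> s /= ts; apply: (le_trans (hK _ _)).
have : (`|K| + 1) * `|t - s| <= e by rewrite mulrC -ler_pdivlMr// ltW.
apply: le_trans; rewrite ler_wpM2r//.
by rewrite (le_trans (ler_norm _))// lerDl.
Qed.

Lemma picard_map_lipschitz x p s t : (forall q, continuous (fun u => x u q)) ->
  `|picard_map x t p - picard_map x s p| <= M * `|t - s|.
Proof.
move=> cx; rewrite /picard_map opprD addrACA subrr add0r.
by apply: Rintegral_lipschitz; [exact: G_meas | move=> u; exact: G_bound].
Qed.

Lemma picard_iter_lipschitz k p s t :
  `|picard_iter k t p - picard_iter k s p| <= M * `|t - s|.
Proof.
elim: k p s t => [|k IH] p s t.
  by rewrite /= subrr normr0 mulr_ge0// M0.
apply: picard_map_lipschitz => q.
by apply: (lipschitz_dist_continuous _ M) => u v; exact: IH.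
Qed.

(* the exponent of the weighted norm for which [picard_map] halves distances *)
Let kappa := 2 * L.
Let C := M / kappa.

Let kappa_gt0 : 0 < kappa. Proof. by rewrite mulr_gt0. Qed.

Lemma picard_map_contraction x y A p t : 0 <= A ->
  (forall q, continuous (fun u => x u q)) -> (forall q, continuous (fun u => y u q)) ->
  (forall q s, 0 <= s -> `|x s q - y s q| <= A * expR (kappa * s)) ->
  `|picard_map x t p - picard_map y t p| <= A / 2 * expR (kappa * t).
Proof.
move=> A0 cx cy xy; rewrite /picard_map opprD addrACA subrr add0r.
have int z : (forall q, continuous (fun u => z u q)) ->
    mu.-integrable `[0, t] (EFin \o (fun s => G s (z s) p)).
  move=> cz; apply: (bounded_integrable_itv _ M) => //; first exact: mu_itvcc_fin.
  exact: G_meas.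
rewrite -RintegralB//; [|exact: int|exact: int].
have -> : A / 2 = L * A / kappa by rewrite /kappa; field; rewrite gt_eqF.
apply: (Rintegral_weighted_le _ (M + M)) => //.
- by rewrite mulr_ge0// ltW.
- by apply: measurable_funB; exact: G_meas.
- by move=> s; rewrite (le_trans (ler_normB _ _))// lerD.
- by move=> s s0; rewrite -mulrA; apply: G_lip => q; exact: xy.
Qed.

Lemma picard_iter_step k p t :
  `|picard_iter k.+1 t p - picard_iter k t p| <= C * expR (kappa * t) * 2^-1 ^+ k.
Proof.
have C0 : 0 <= C by rewrite divr_ge0 ?(ltW kappa_gt0)// M0.
elim: k p t => [|k IH] p t.
  rewrite expr0 mulr1 /= /picard_map addrC addKr.
  apply: (Rintegral_weighted_le _ M) => //; first exact: M0.
    by apply: G_meas => q; exact: cst_continuous.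
  move=> s s0; apply: (le_trans (G_bound _ _ _)).
  rewrite -[leLHS]mulr1 ler_wpM2l ?M0// -expR0 ler_expR.
  by rewrite mulr_ge0// ltW.
have ck m : forall q, continuous (fun u => picard_iter m u q).
  by move=> q; apply: (lipschitz_dist_continuous _ M) => u v; exact: picard_iter_lipschitz.
rewrite [picard_iter k.+2]iterS [X in _ - X]/= -/(picard_iter k.+1).
have -> : C * expR (kappa * t) * 2^-1 ^+ k.+1 = C * 2^-1 ^+ k / 2 * expR (kappa * t).
  by rewrite exprS; ring.
apply: picard_map_contraction => //.
  by rewrite mulr_ge0// exprn_ge0// invr_ge0.
by move=> q s s0; rewrite (le_trans (IH q s))// mulrAC.
Qed.

(** The Picard-Lindelof theorem for a field which is bounded, uniformly Lipschitz
    in the state, and along continuous curves measurable in time and continuous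
    off [S].  The curve is extended by its initial value before time 0, which
    makes it continuous on the whole line. *)
Lemma picard : exists x, [/\ forall p t, t <= 0 -> x t p = x0 p,
  forall p, continuous (fun t => x t p) &
  forall p t, 0 < t -> ~ S t ->
    is_derive t (1 : R) (fun s => x s p) (G t (x t) p)].
Proof.
have H (tp : R * I) : exists l : R, forall k, `|l - picard_iter k tp.1 tp.2| <=
    2 * (C * expR (kappa * tp.1)) * 2^-1 ^+ k.
  by apply: geometric_limit => k; exact: picard_iter_step.
have [x' Hx'] := choice H; pose x t p := x' (t, p).
have {H Hx'} Hx t p k : `|x t p - picard_iter k t p| <=
  2 * (C * expR (kappa * t)) * 2^-1 ^+ k := Hx' (t, p) k.
have ck m : forall q, continuous (fun u => picard_iter m u q).
  by move=> q; apply: (lipschitz_dist_continuous _ M) => u v; exact: picard_iter_lipschitz.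
have cx p : continuous (fun t => x t p).
  apply: (lipschitz_dist_continuous _ M) => s t.
  apply/ler_addgt0Pl => e e0.
  have [k kP] := geometric_small (2 * (C * expR (kappa * t)) + 2 * (C * expR (kappa * s))) e e0.
  have h1 := Hx t p k; have h2 := Hx s p k.
  rewrite distrC in h2.
  have h3 := picard_iter_lipschitz k p s t.
  have -> : x t p - x s p = (x t p - picard_iter k t p) +
    (picard_iter k s p - x s p) + (picard_iter k t p - picard_iter k s p) by ring.
  rewrite (le_trans (ler_normD _ _))// lerD// (le_trans (ler_normD _ _))//.
  by apply: le_trans kP; rewrite mulrDl lerD.
have C0 : I -> 0 <= C by move=> p; rewrite divr_ge0 ?(ltW kappa_gt0)// (M0 p).
have fix_x t p : x t p = picard_map x t p.
  apply/eqP; rewrite -subr_eq0 -normr_le0; apply/ler_addgt0Pl => e e0.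
  rewrite addr0.
  have [k kP] := geometric_small (2 * (C * expR (kappa * t))) e e0.
  apply: le_trans kP.
  have h1 := Hx t p k.+1.
  have h2 : `|picard_iter k.+1 t p - picard_map x t p| <=
      2 * C * 2^-1 ^+ k / 2 * expR (kappa * t).
    apply: picard_map_contraction => //.
      by rewrite mulr_ge0 ?exprn_ge0 ?invr_ge0// mulr_ge0// (C0 p).
    move=> q s _; rewrite distrC (le_trans (Hx s q k))//.
    by rewrite !mulrA mulrAC.
  have -> : x t p - picard_map x t p = (x t p - picard_iter k.+1 t p) +
    (picard_iter k.+1 t p - picard_map x t p) by ring.
  apply: (le_trans (ler_normD _ _)); apply: (le_trans (lerD h1 h2)).
  by rewrite exprS le_eqVlt; apply/orP; left; apply/eqP; field.
exists x; split=> //.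
  move=> p t; rewrite fix_x /picard_map le_eqVlt => /predU1P[->|t0].
    by rewrite set_itv1 Rintegral_set1 addr0.
  by rewrite Rintegral_lt0// addr0.
move=> p t t0 nS.
have -> : (fun s => x s p) =
    cst (x0 p) + (fun s => \int[mu]_(u in `[0, s]) G u (x u) p).
  by apply/funext => s; rewrite fix_x.
have t1 : t < t + 1 by rewrite ltrDl.
have intG : mu.-integrable `[0, t + 1] (EFin \o (fun s => G s (x s) p)).
  by apply: (bounded_integrable_itv _ M) => //; [exact: mu_itvcc_fin | exact: G_meas].
have [d1 d2] := continuous_FTC1_closed t1 intG t0 (G_cont x cx p t nS).
rewrite -[G t _ _]add0r; apply: is_deriveD.
by rewrite derive1E in d2; exact: DeriveDef d1 d2.
Qed.

End Picard.

(** * Bounded Lipschitz functions and switched fields *)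

Lemma max_dist {R : realType} (r x y : R) :
  `|Num.max x r - Num.max y r| <= `|x - y|.
Proof.
case: (leP x r) => xr; case: (leP y r) => yr; rewrite ?subrr ?normr0//.
- by rewrite distrC [leRHS]distrC !ger0_norm; lra.
- by rewrite !ger0_norm; lra.
Qed.

Section BoundedLipschitz.
Context {R : realType} {I : Type}.
Implicit Types (phi psi : (I -> R) -> R).

(** Bounded functions of [u : I -> R] which are Lipschitz for the sup distance;
    the latter is not mentioned, only its upper bounds [e]. *)
Definition bounded_lipschitz phi :=
  exists B L : R, [/\ 0 <= L, forall u, `|phi u| <= B &
    forall u v e, (forall p, `|u p - v p| <= e) -> `|phi u - phi v| <= L * e].

Lemma bounded_lipschitz_cst (c : R) : bounded_lipschitz (fun=> c).
Proof.
by exists `|c|, 0; split=> // u v e _; rewrite subrr normr0 mul0r.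
Qed.

Lemma bounded_lipschitzD phi psi : bounded_lipschitz phi ->
  bounded_lipschitz psi -> bounded_lipschitz (fun u => phi u + psi u).
Proof.
move=> [B [L [L0 HB HL]]] [B' [L' [L0' HB' HL']]].
exists (B + B'), (L + L'); split; first exact: addr_ge0.
  by move=> u; rewrite (le_trans (ler_normD _ _))// lerD.
move=> u v e uv; rewrite opprD addrACA mulrDl.
by rewrite (le_trans (ler_normD _ _))// lerD// ?HL ?HL'.
Qed.

Lemma bounded_lipschitzM phi psi : bounded_lipschitz phi ->
  bounded_lipschitz psi -> bounded_lipschitz (fun u => phi u * psi u).
Proof.
move=> [B [L [L0 HB HL]]] [B' [L' [L0' HB' HL']]].
have B0 : (I -> R) -> 0 <= B by move=> u; exact: le_trans (normr_ge0 _) (HB u).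
have B0' : (I -> R) -> 0 <= B' by move=> u; exact: le_trans (normr_ge0 _) (HB' u).
exists (B * B'), (`|B| * L' + `|B'| * L); split.
- by rewrite addr_ge0// mulr_ge0.
- by move=> u; rewrite normrM ler_pM.
move=> u v e uv.
have -> : phi u * psi u - phi v * psi v =
  phi u * (psi u - psi v) + psi v * (phi u - phi v) by ring.
rewrite (le_trans (ler_normD _ _))// !normrM mulrDl -!mulrA.
rewrite lerD// ler_pM ?HL ?HL'//.
  by rewrite (le_trans (HB _))// ler_norm.
by rewrite (le_trans (HB' _))// ler_norm.
Qed.

Lemma bounded_lipschitzB phi psi : bounded_lipschitz phi ->
  bounded_lipschitz psi -> bounded_lipschitz (fun u => phi u - psi u).
Proof.
move=> bphi bpsi.
have := bounded_lipschitzD _ _ bphi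
  (bounded_lipschitzM _ _ (bounded_lipschitz_cst (-1)) bpsi).
by under eq_fun do rewrite mulN1r.
Qed.

Lemma bounded_lipschitz_comp (h : R -> R) phi : bounded_lipschitz phi ->
  (exists2 K, 0 <= K & forall x y, `|h x - h y| <= K * `|x - y|) ->
  bounded_lipschitz (fun u => h (phi u)).
Proof.
move=> [B [L [L0 HB HL]]] [K K0 HK].
exists (`|h 0| + K * B), (K * L); split; first exact: mulr_ge0.
  move=> u; rewrite -[h _](subrK (h 0)) addrC (le_trans (ler_normD _ _))// lerD2l.
  by rewrite (le_trans (HK _ _))// subr0 ler_wpM2l.
move=> u v e uv; rewrite (le_trans (HK _ _))// -mulrA ler_wpM2l//.
exact: HL.
Qed.

Lemma bounded_lipschitzV (r : R) phi : 0 < r -> (forall u, r <= phi u) ->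
  bounded_lipschitz phi -> bounded_lipschitz (fun u => (phi u)^-1).
Proof.
move=> r0 rphi [B [L [L0 HB HL]]].
have phi0 u : 0 < phi u := lt_le_trans r0 (rphi u).
have iphi u : (phi u)^-1 <= r^-1 by rewrite lef_pV2 ?posrE.
exists r^-1, (r^-1 * r^-1 * L); split.
- by rewrite !mulr_ge0// invr_ge0 ltW.
- by move=> u; rewrite ger0_norm ?iphi// invr_ge0 ltW.
move=> u v e uv.
have -> : (phi u)^-1 - (phi v)^-1 = (phi u)^-1 * (phi v)^-1 * (phi v - phi u).
  by field; rewrite !gt_eqF.
rewrite !normrM !normfV ![`|phi _|]gtr0_norm// -[leRHS]mulrA ler_pM//.
- by rewrite mulr_ge0// invr_ge0 ltW.
- by rewrite ler_pM// invr_ge0 ltW.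
- by rewrite distrC HL.
Qed.

Lemma bounded_lipschitz_max (r : R) phi :
  bounded_lipschitz phi -> bounded_lipschitz (fun u => Num.max (phi u) r).
Proof.
move=> bphi; apply: (bounded_lipschitz_comp (Num.max^~ r)) => //.
by exists 1 => // x y; rewrite mul1r max_dist.
Qed.

Lemma bounded_lipschitz_enorm d (F : (I -> R) -> 'rV[R]_d) :
  (forall k, bounded_lipschitz (fun u => F u 0 k)) ->
  bounded_lipschitz (fun u => enorm (F u)).
Proof.
move=> /choice[B /choice[L HBL]].
exists (\sum_k B k), (\sum_k L k); split.
- by apply: sumr_ge0 => k _; have [] := HBL k.
- move=> u; rewrite ger0_norm ?enorm_ge0//.
  apply: (le_trans (enorm_le_sum _)); apply: ler_sum => k _.
  by have [_ ->] := HBL k.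
move=> u v e uv; apply: (le_trans (ler_dist_enorm _ _)).
apply: (le_trans (enorm_le_sum _)); rewrite mulr_suml; apply: ler_sum => k _.
by have [_ _ H] := HBL k; rewrite !mxE H.
Qed.

End BoundedLipschitz.

(** Projection of the real line onto [- B, B]. *)
Definition clamp {R : realType} (B a : R) : R := Num.max (- B) (Num.min B a).

Section Clamp.
Context {R : realType}.
Implicit Types B a b : R.

Lemma clamp_id B a : `|a| <= B -> clamp B a = a.
Proof. by rewrite ler_norml => /andP[Ba aB]; rewrite /clamp min_r// max_r. Qed.

Lemma clamp_le B a b : a <= b -> clamp B a <= clamp B b.
Proof. by move=> ab; rewrite /clamp le_max2// le_min2. Qed.

Lemma clamp_norm B a : 0 <= B -> `|clamp B a| <= B.
Proof.
move=> B0; rewrite /clamp ler_norml le_max lexx/= ge_max ge_min lexx andbT.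
by rewrite lerNl (le_trans _ B0)// oppr_le0.
Qed.

Lemma clamp_lipschitz B a b : `|clamp B a - clamp B b| <= `|a - b|.
Proof.
rewrite /clamp ![Num.max (- B) _]maxC; apply: (le_trans (max_dist _ _ _)).
have -> : Num.min B a - Num.min B b = Num.max (- b) (- B) - Num.max (- a) (- B).
  by rewrite ![Num.max _ (- B)]maxC -!oppr_min; ring.
by apply: (le_trans (max_dist _ _ _)); rewrite opprK addrC.
Qed.

Lemma bounded_lipschitz_clamp {I : Type} B (p : I) : 0 <= B ->
  bounded_lipschitz (fun u => clamp B (u p)).
Proof.
move=> B0; exists B, 1; split=> // u; first exact: clamp_norm.
by move=> v e uv; rewrite mul1r (le_trans (clamp_lipschitz _ _ _)).
Qed.

End Clamp.

Section SwitchedPicard.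
Context {R : realType} {I J : finType}.
Variables (chi : I -> J -> R -> bool) (phi : I -> J -> (I -> R) -> R) (S : set R).
Hypothesis chi_meas : forall p j, measurable [set t | chi p j t].
Hypothesis chi_cst : forall p j t, ~ S t -> \forall s \near t, chi p j s = chi p j t.
Hypothesis phi_bl : forall p j, bounded_lipschitz (phi p j).

(** A sum of bounded Lipschitz terms, each switched on and off in time. *)
Definition switched_field (t : R) (u : I -> R) (p : I) : R :=
  \sum_j (chi p j t)%:R * phi p j u.

Lemma bounded_lipschitz_continuous (psi : (I -> R) -> R) (x : R -> I -> R) :
  bounded_lipschitz psi -> (forall p, continuous (fun t => x t p)) ->
  continuous (fun t => psi (x t)).
Proof.
move=> [B [L [L0 _ HL]]] cx t; apply/cvgrPdist_le => e e0.
have L1 : 0 < L + 1 by rewrite ltr_wpDl.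
have e1 : 0 < e / (L + 1) by rewrite divr_gt0.
have H : \forall s \near t, forall p, `|x t p - x s p| <= e / (L + 1).
  apply: (@filter_forall R I (fun p s => `|x t p - x s p| <= e / (L + 1)) (nbhs t)).
  move=> p; by have /cvgrPdist_le := cx p t; apply.
apply: filterS H => s H; apply: (le_trans (HL _ _ _ H)).
by rewrite mulrA ler_pdivrMr// mulrC ler_pM2l// lerDl.
Qed.

Lemma switched_picard (x0 : I -> R) : exists x : R -> I -> R,
  [/\ forall p t, t <= 0 -> x t p = x0 p,
      forall p, continuous (fun t => x t p) &
      forall p t, 0 < t -> ~ S t ->
        is_derive t (1 : R) (fun s => x s p) (switched_field t (x t) p)].
Proof.
have /choice[B /choice[L HBL]] : forall pj, exists B L : R, [/\ 0 <= L,
    forall u, `|phi pj.1 pj.2 u| <= B &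
    forall u v e, (forall q, `|u q - v q| <= e) ->
      `|phi pj.1 pj.2 u - phi pj.1 pj.2 v| <= L * e].
  by move=> pj; exact: phi_bl.
have term t p j u : `|(chi p j t)%:R * phi p j u| <= `|phi p j u|.
  by rewrite normrM; case: chi; rewrite ?normr1 ?mul1r// normr0 mul0r.
have L_ge0 pj : 0 <= L pj by have [] := HBL pj.
have sum_le (F : I * J -> R) p : (forall q, 0 <= F q) ->
    \sum_j F (p, j) <= \sum_q F q.
  move=> F0; rewrite (eq_bigr (fun q => F (q.1, q.2))); last by case.
  rewrite -(pair_bigA _ (fun p j => F (p, j)))/= (bigD1 p)//= lerDl.
  by apply: sumr_ge0 => q _; exact: sumr_ge0.
apply: (picard _ S (\sum_q `|B q|) (\sum_q L q + 1)).
- by rewrite ltr_wpDl// sumr_ge0.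
- move=> t u p; apply: le_trans (sum_le (fun q => `|B q|) p _) => //.
  apply: (le_trans (ler_norm_sum _ _ _)); apply: ler_sum => j _.
  apply: (le_trans (term _ _ _ _)).
  by have [_ H _] := HBL (p, j); rewrite (le_trans (H u))// ler_norm.
- move=> t u v e uv p; rewrite /switched_field -sumrB.
  have e0 : 0 <= e := le_trans (normr_ge0 _) (uv p).
  apply: (@le_trans _ _ ((\sum_q L q) * e)); last by rewrite ler_wpM2r// lerDl.
  apply: (@le_trans _ _ (\sum_j L (p, j) * e)); last first.
    by rewrite -mulr_suml ler_wpM2r// sum_le.
  apply: (le_trans (ler_norm_sum _ _ _)); apply: ler_sum => j _.
  rewrite -mulrBr normrM.
  have [_ _ H] := HBL (p, j); apply: le_trans (H u v e uv).
  by case: chi; rewrite ?normr1 ?mul1r// normr0 mul0r.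
- move=> x cx p; apply: measurable_sum => j.
  apply: measurable_funM; last first.
    by apply: continuous_measurable_fun; exact: bounded_lipschitz_continuous.
  have -> : (fun t => (chi p j t)%:R) = \1_[set t | chi p j t] :> (R -> R).
    apply/funext => t; rewrite indicE.
    have -> : (t \in [set s | chi p j s]) = chi p j t by apply/idP/idP; rewrite inE.
    by [].
  exact: measurable_indic.
move=> x cx p t nS; rewrite /switched_field.
pose g s := \sum_j (chi p j t)%:R * phi p j (x s).
have cg : continuous g.
  rewrite /g; elim: (index_enum _) => [|j s IH] u.
    by under eq_fun do rewrite big_nil; exact: cvg_cst.
  under eq_fun do rewrite big_cons; apply: cvgD; last exact: IH.
  apply: cvgM; first exact: cvg_cst.
  exact: (bounded_lipschitz_continuous _ _ (phi_bl p j) cx).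
have chi_t : \forall s \near t, forall j, chi p j s = chi p j t.
  apply: (@filter_forall R J (fun j s => chi p j s = chi p j t) (nbhs t)) => j.
  exact: chi_cst.
apply/cvgrPdist_le => e e0.
have /cvgrPdist_le/(_ e e0) := cg t.
apply: filterS2 chi_t => s chis.
have <- : g s = \sum_j (chi p j s)%:R * phi p j (x s).
  by apply: eq_bigr => j _; rewrite chis.
by [].
Qed.

End SwitchedPicard.

(** * The system with truncated norms *)

Lemma lipschitz_dist {R : realType} (h : R -> R) : lipschitz h ->
  exists2 L, 0 < L & forall x y, `|h x - h y| <= L * `|x - y|.
Proof.
move=> [M [_ HM]]; exists (`|M| + 1); first by rewrite ltr_wpDl.
have MM : M < `|M| + 1 by rewrite ltr_pwDr// ler_norm.
by move=> x y; exact: (HM _ MM (x, y) (conj I I)).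
Qed.

Lemma positive_lipschitz_ge0 {R : realType} (h : R -> R) : lipschitz h ->
  (forall x, 0 < x -> 0 < h x) -> forall x, 0 <= x -> 0 <= h x.
Proof.
move=> /lipschitz_dist[L L0 HL] hpos x; rewrite le_eqVlt => /predU1P[<-|/hpos/ltW//].
rewrite leNgt; apply/negP => h0.
pose e := - h 0 / L.
have e0 : 0 < e by rewrite divr_gt0// oppr_gt0.
have := HL e 0; rewrite subr0 (gtr0_norm e0) mulrC divfK ?gt_eqF//.
have := hpos _ e0; rewrite ler_norml => ? /andP[_]; lra.
Qed.

(** The arguments of the weights are distances between vectors of norm at most 1,
    hence lie in [0, 2]. *)
Lemma bounded_weights {R : realType} {n : nat} (f : 'I_n -> 'I_n -> R -> R) :
  (forall i j, lipschitz (f i j)) ->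
  exists2 F, 0 <= F & forall i j x, 0 <= x <= 2 -> f i j x <= F.
Proof.
move=> f_lip.
have /choice[B BP] : forall ij, exists B : R, forall x, 0 <= x <= 2 ->
    `|f ij.1 ij.2 x| <= B.
  move=> [i j]; have [L L0 HL] := lipschitz_dist _ (f_lip i j).
  exists (`|f i j 0| + L * 2) => x /andP[x0 x2] /=.
  rewrite -[X in `|X|](subrK (f i j 0)) addrC; apply: (le_trans (ler_normD _ _)).
  rewrite lerD2l; apply: (le_trans (HL _ _)).
  by rewrite subr0 ger0_norm// ler_pM2l.
exists (\sum_ij `|B ij|); first by rewrite sumr_ge0.
move=> i j x x02; apply: le_trans (ler_norm _) _.
apply: (le_trans (BP (i, j) x x02)).
apply: (le_trans (ler_norm _)).
by rewrite (bigD1 (i, j))//= lerDl sumr_ge0.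
Qed.

Section TruncatedDynamics.
Context {R : realType} {n d : nat}.
Variables (f : 'I_n -> 'I_n -> R -> R) (N : 'I_n -> R -> {set 'I_n}).
Hypothesis f_lip : forall i j, lipschitz (f i j).
Hypothesis f_pos : forall i j (x : R), 0 < x -> 0 < f i j x.

(** The coefficient of [x j - x i] in the velocity of agent [i], with truncated
    norms. *)
Definition trunc_weight (r : R) (x : state R n d) i j : R :=
  f i j (enorm (trunc_direction r (x j) - trunc_direction r (x i)))
  * (trunc_enorm r (x i) / trunc_enorm r (x j)).

(** The right-hand side of the system with truncated norms. *)
Definition trunc_rhs (r t : R) (x : state R n d) : state R n d := fun i =>
  \sum_(j in N i t) trunc_weight r x i j *: (x j - x i).

Lemma trunc_weight_ge0 r x i j : 0 <= trunc_weight r x i j.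
Proof.
apply: mulr_ge0; last by rewrite divr_ge0// trunc_enorm_ge0.
apply: positive_lipschitz_ge0 => //; [exact: f_pos | exact: enorm_ge0].
Qed.

(** Where all the norms are at least [r], truncation has no effect; at the level
    [r = 0] this is the case everywhere. *)
Lemma trunc_rhsE r t (x : state R n d) i : (forall j, r <= enorm (x j)) ->
  trunc_rhs r t x i = rhs f N t x i.
Proof.
move=> xr; apply: eq_bigr => j _; rewrite /trunc_weight.
by rewrite /trunc_direction !trunc_enorm_id.
Qed.

Lemma dot_trunc_rhs r t (x : state R n d) i u :
  dot u (trunc_rhs r t x i) =
  \sum_(j in N i t) trunc_weight r x i j * (dot u (x j) - dot u (x i)).
Proof. by rewrite dot_sumr; apply: eq_bigr => j _; rewrite dotZr dotBr. Qed.

(** For an agent of minimal norm the ratio [enorm (x i) / enorm (x j)] is at most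
    1, so the decay of its norm is at most exponential. *)
Lemma dot_trunc_rhs_ge (F r t : R) (x : state R n d) i :
  0 <= F -> (forall i j x, 0 <= x <= 2 -> f i j x <= F) -> 0 <= r ->
  (forall j, enorm (x i) <= enorm (x j)) -> r <= enorm (x i) -> x i != 0 ->
  - (2 * n%:R * F * enorm (x i) ^+ 2) <= dot (x i) (trunc_rhs r t x i).
Proof.
move=> F0 fF r0 xmin xr; rewrite -enorm_gt0 => xi0; rewrite dot_trunc_rhs.
have H j : - (2 * F * enorm (x i) ^+ 2) <=
    trunc_weight r x i j * (dot (x i) (x j) - dot (x i) (x i)).
  have xj0 : 0 < enorm (x j) := lt_le_trans xi0 (xmin j).
  rewrite -sqr_enorm.
  apply: (@le_trans _ _ (trunc_weight r x i j * - (2 * enorm (x i) * enorm (x j)))).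
    rewrite /trunc_weight ![trunc_enorm _ _]trunc_enorm_id//; last exact: le_trans (xmin j).
    rewrite mulrN lerN2.
    set w := f i j _.
    have -> : w * (enorm (x i) / enorm (x j)) * (2 * enorm (x i) * enorm (x j)) =
        2 * w * enorm (x i) ^+ 2.
      by field; rewrite gt_eqF.
    rewrite ler_wpM2r ?sqr_ge0// ler_wpM2l//.
    by apply: fF; rewrite enorm_ge0 enorm_trunc_directionB.
  apply: ler_wpM2l; first exact: trunc_weight_ge0.
  have := dot_ge_enorm (x i) (x j).
  have : enorm (x i) ^+ 2 <= enorm (x i) * enorm (x j).
    by rewrite expr2 ler_wpM2l ?enorm_ge0.
  lra.
apply: (@le_trans _ _ (\sum_(j in N i t) - (2 * F * enorm (x i) ^+ 2))).
  rewrite sumr_const mulNrn lerN2 -[leLHS]mulr_natr.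
  have -> : 2 * n%:R * F * enorm (x i) ^+ 2 = 2 * F * enorm (x i) ^+ 2 * n%:R by ring.
  apply: ler_wpM2l; first by rewrite mulr_ge0 ?sqr_ge0 ?mulr_ge0.
  by rewrite ler_nat (leq_trans (max_card _)) ?card_ord.
by apply: ler_sum => j _.
Qed.

End TruncatedDynamics.

Section LowerBound.
Context {R : realType} {n d : nat}.
Variables (f : 'I_n -> 'I_n -> R -> R) (N : 'I_n -> R -> {set 'I_n}).
Hypothesis f_lip : forall i j, lipschitz (f i j).
Hypothesis f_pos : forall i j (x : R), 0 < x -> 0 < f i j x.
Hypothesis N_rc : forall i, right_continuous_signal (N i).

(** By right continuity, no switching follows a given time immediately. *)
Lemma switching_right t : exists2 e : R, 0 < e &
  forall s, t < s < t + e -> ~ switching_time N s.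
Proof.
have H : \forall s \near t^'+, forall i, N i s = N i t.
  by apply: filter_forall => i; exact: N_rc.
have [e /= e0 eP] := H.
exists e => // s /andP[ts se] [i]; apply.
have {}eP u : t < u < t + e -> N i u = N i t.
  move=> /andP[tu ue]; apply: eP => //=.
  by rewrite ltr_norml; apply/andP; split; lra.
have : \forall u \near s, t < u < t + e.
  near=> u; apply/andP; split; near: u; [exact: lt_nbhsr|exact: lt_nbhsl].
apply: filterS => u ute.
by rewrite !eP// ts se.
Unshelve. all: by end_near. Qed.

(** The squared norms stay above an exponential, as long as the latter is larger
    than the square of the truncation level.  For [r = 0] this is about the
    original system, and for [0 < r] it shows that the truncation is not
    reached.  The equation is assumed only at states without zero component whose
    norms are at least [r]. *)
Lemma enorm_lower_bound (F r rho a b : R) (y : R -> state R n d) :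
  0 <= F -> (forall i j x, 0 <= x <= 2 -> f i j x <= F) ->
  0 <= r -> 0 <= rho ->
  (forall i, {within `[a, b], continuous (fun t => y t i)}) ->
  (forall t, a < t <= b -> ~ switching_time N t -> nonvanishing (y t) ->
     (forall i, r <= enorm (y t i)) ->
     forall i, is_derive t (1 : R) (fun s => y s i) (trunc_rhs f N r t (y t) i)) ->
  (forall i, rho <= enorm (y a i)) ->
  r ^+ 2 < rho ^+ 2 * expR (- (4 * n%:R * F) * (b - a)) ->
  forall i t, a <= t <= b ->
    rho ^+ 2 * expR (- (4 * n%:R * F) * (t - a)) <= enorm (y t i) ^+ 2.
Proof.
move=> F0 fF r0 rho0 cy dy ya rb i t tab.
pose c := 4 * n%:R * F; rewrite -/c in rb *.
have c0 : 0 <= c by rewrite !mulr_ge0.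
pose w s := rho ^+ 2 * expR (- c * (s - a)).
have wb s : s <= b -> w b <= w s.
  move=> sb; rewrite /w ler_wpM2l ?sqr_ge0// ler_expR ler_wnM2l ?oppr_le0//.
  by rewrite lerB.
pose g (j : 'I_n) s := w s - dot (y s j) (y s j).
(* the maximum principle for the deficits, whose largest one belongs to the agent
   of smallest norm *)
suff : g i t <= 0 by rewrite /g subr_le0 sqr_enorm.
have eta0 : 0 < w b - r ^+ 2 by rewrite subr_gt0.
apply: (max_principle g (switching_time N) a b 0 (w b - r ^+ 2)) => //.
- move=> j x; apply: cvgB; last by apply: within_continuous_dot; exact: cy.
  have : continuous w.
    move=> s; apply: cvgM; first exact: cvg_cst.
    apply: (@continuous_comp _ _ _ (fun s => - c * (s - a)) expR); last exact: continuous_expR.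
    apply: cvgM; first exact: cvg_cst.
    by apply: cvgB; [exact: cvg_id|exact: cvg_cst].
  by move=> cw; apply: continuous_subspaceT.
- exact: switching_right.
- move=> j; rewrite /g /w subrr mulr0 expR0 mulr1 subr_le0 -sqr_enorm.
  by rewrite ler_sqr ?nnegrE ?enorm_ge0.
move=> j s sab nS gmax /andP[g0 geta].
have [as_ sb] := andP sab.
(* the bound on the deficit keeps the smallest norm above [r] *)
have rj : r < enorm (y s j).
  rewrite -ltr_sqr ?nnegrE ?enorm_ge0// sqr_enorm.
  by have := wb s sb; move: geta; rewrite /g; lra.
have jmin k : enorm (y s j) <= enorm (y s k).
  rewrite -ler_sqr ?nnegrE ?enorm_ge0// !sqr_enorm.
  by have := gmax k; rewrite /g; lra.
have rk k : r <= enorm (y s k) by rewrite (le_trans (ltW rj)).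
have nv : nonvanishing (y s).
  by move=> k; rewrite -enorm_gt0 (le_lt_trans r0)// (lt_le_trans rj).
have dyj := is_derive_dot_self _ _ _ (dy s sab nS nv rk j).
have dw : is_derive s (1 : R) w (- c * w s).
  have d1 : is_derive s (1 : R) (fun u => - c * (u - a)) (- c).
    by apply: is_derive_eq; rewrite subr0 ?scaler0 ?add0r /GRing.scale/= mulr1.
  have d2 := is_derive1_comp (f := expR) (is_derive_expR _) d1.
  have := is_deriveZ (rho ^+ 2) d2.
  by move=> /is_derive_eq; apply; rewrite /w /GRing.scale/=; ring.
eexists; first exact: is_deriveB dw dyj.
rewrite mul0r.
have := dot_trunc_rhs_ge f N f_lip f_pos F r s (y s) j F0 fF r0 jmin (ltW rj) (nv j).
rewrite sqr_enorm.
have : 0 <= c * g j s by rewrite mulr_ge0// ltW.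
rewrite /g -/(w s) /c.
set D := dot _ (trunc_rhs _ _ _ _ _ _).
set E := dot _ _.
set W := w s.
set q := n%:R * F.
have -> : 4 * n%:R * F * (W - E) = 4 * (q * W) - 4 * (q * E) by rewrite /q; ring.
have -> : 2 * n%:R * F * E = 2 * (q * E) by rewrite /q; ring.
have -> : - (4 * n%:R * F) * W = - 4 * (q * W) by rewrite /q; ring.
lra.
Qed.

End LowerBound.

(** * Invariance and uniqueness *)

Section Trajectories.
Context {R : realType} {n d : nat}.
Variables (f : 'I_n -> 'I_n -> R -> R) (N : 'I_n -> R -> {set 'I_n}).
Hypothesis f_lip : forall i j, lipschitz (f i j).
Hypothesis f_pos : forall i j (x : R), 0 < x -> 0 < f i j x.
Hypothesis N_rc : forall i, right_continuous_signal (N i).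
Implicit Types (y z : R -> state R n d) (x : state R n d).

(** A trajectory on the closed interval [a, b], with the equation also imposed
    at [b]. *)
Definition closed_trajectory (a b : R) y :=
  (forall i, {within `[a, b], continuous (fun t => y t i)}) /\
  (forall t, a < t <= b -> ~ switching_time N t -> nonvanishing (y t) ->
     forall i, is_derive t (1 : R) (fun s => y s i) (rhs f N t (y t) i)).

Lemma trajectory_closed (a c : R) (b : \bar R) y :
  trajectory f N a b y -> (c%:E < b)%E -> closed_trajectory a c y.
Proof.
move=> [cy dy] cb; split=> [i|t /andP[at_ tc]].
  apply: continuous_subspaceW (cy i) => t /=.
  rewrite in_itv/= => /andP[at_ tc]; split=> //.
  by rewrite (le_lt_trans _ cb)// lee_fin.
by apply: dy => //; rewrite (le_lt_trans _ cb)// lee_fin.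
Qed.

Lemma enorm_pos_lower (x : state R n d) : nonvanishing x ->
  exists2 rho, 0 < rho & forall i, rho <= enorm (x i).
Proof.
move=> nx; pose s := 1 + \sum_i (enorm (x i))^-1.
have V0 i : 0 <= (enorm (x i))^-1 by rewrite invr_ge0 enorm_ge0.
have s0 : 0 < s by rewrite ltr_pwDl// sumr_ge0.
exists s^-1; first by rewrite invr_gt0.
move=> i; rewrite -[leRHS]invrK lef_pV2 ?posrE ?invr_gt0 ?enorm_gt0//.
by rewrite /s (bigD1 i)//= addrCA lerDl addr_ge0// sumr_ge0.
Qed.

Lemma small_sqr (e : R) : 0 < e -> exists2 r, 0 < r & r ^+ 2 < e.
Proof.
move=> e0; have e1 : 0 < 1 + e by rewrite ltr_wpDl.
exists (e / (1 + e)); first exact: divr_gt0.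
rewrite expr_div_n ltr_pdivrMr ?exprn_gt0//; nra.
Qed.

(** Along a trajectory all the norms remain above a positive bound. *)
Lemma closed_trajectory_lower (a b : R) (x : state R n d) : nonvanishing x ->
  exists2 r, 0 < r & forall y, closed_trajectory a b y -> y a = x ->
    forall t, a <= t <= b -> forall i, r <= enorm (y t i).
Proof.
move=> nx; have [rho rho0 rhoP] := enorm_pos_lower x nx.
have [F F0 fF] := bounded_weights f f_lip.
set m := rho ^+ 2 * expR (- (4 * n%:R * F) * (b - a)).
have m0 : 0 < m by rewrite mulr_gt0 ?expR_gt0 ?exprn_gt0.
have [r r0 rm] := small_sqr m m0.
exists r => // y [cy dy] yx t tab i.
have H : rho ^+ 2 * expR (- (4 * n%:R * F) * (t - a)) <= enorm (y t i) ^+ 2.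
  have dy' s : a < s <= b -> ~ switching_time N s -> nonvanishing (y s) ->
      (forall k, 0 <= enorm (y s k)) ->
      forall k, is_derive s (1 : R) (fun u => y u k) (trunc_rhs f N 0 s (y s) k).
    by move=> sab nS nv yr k; rewrite trunc_rhsE//; exact: dy.
  have ya k : rho <= enorm (y a k) by rewrite yx.
  have m0' : 0 ^+ 2 < m by rewrite expr0n.
  exact: (enorm_lower_bound f N f_lip f_pos N_rc F 0 rho a b y F0 fF (lexx 0)
    (ltW rho0) cy dy' ya m0' i t tab).
rewrite -(@ler_pXn2r _ 2) ?nnegrE ?enorm_ge0 ?(ltW r0)//.
apply: le_trans (ltW rm) _; apply: le_trans H.
rewrite ler_wpM2l ?sqr_ge0// ler_expR ler_wnM2l ?oppr_le0 ?mulr_ge0//.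
by have /andP[_ tb] := tab; rewrite lerB.
Qed.

Lemma closed_trajectory_nonvanishing (a b t : R) y : closed_trajectory a b y ->
  nonvanishing (y a) -> a <= t <= b -> nonvanishing (y t).
Proof.
move=> ty ny tab i; have [r r0 H] := closed_trajectory_lower a b _ ny.
by rewrite -enorm_gt0 (lt_le_trans r0)// (H y).
Qed.

(** The maximum over the agents of a linear functional does not increase. *)
Lemma closed_trajectory_dot_le (a b t m : R) u y : closed_trajectory a b y ->
  nonvanishing (y a) -> (forall i, dot u (y a i) <= m) -> a <= t <= b ->
  forall i, dot u (y t i) <= m.
Proof.
move=> ty ny um tab i; rewrite -subr_le0; have [cy dy] := ty.
apply: (max_principle (fun i s => dot u (y s i) - m) (switching_time N) a b 0 1) => //.
- move=> k s; apply: cvgB; last exact: cvg_cst.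
  by apply: within_continuous_dot => //; apply: continuous_subspaceT; exact: cst_continuous.
- exact: switching_right.
- by move=> k; rewrite subr_le0.
move=> k s sab nS kmax _; rewrite mul0r.
have nys : nonvanishing (y s).
  apply: (closed_trajectory_nonvanishing a b s y ty ny).
  by have /andP[/ltW -> ->] := sab.
exists (dot u (rhs f N s (y s) k)).
  rewrite -[dot u _]subr0; apply: is_deriveB.
  by apply: is_derive_dot; exact: dy.
rewrite -(trunc_rhsE f N 0); last by move=> j; exact: enorm_ge0.
rewrite dot_trunc_rhs; apply: sumr_le0 => j _.
rewrite mulr_ge0_le0 ?trunc_weight_ge0// subr_le0.
by have := kmax j; rewrite lerD2r.
Qed.

Lemma forward_invariant_nonvanishing :
  forward_invariant f N (cartesian_power (~` [set (0 : 'rV[R]_d)])).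
Proof.
move=> a b y _ ty _ ny t [at_ tb] i; apply/eqP.
apply: (closed_trajectory_nonvanishing a t t y (trajectory_closed _ _ _ _ ty tb) ny).
by rewrite at_ lexx.
Qed.

Lemma forward_invariant_convex_hull (p : 'I_n -> 'rV[R]_d) :
  forward_invariant f N
    (cartesian_power (convex_hull [set p i | i in [set: 'I_n]])).
Proof.
move=> a b y _ ty Hy ny t [at_ tb] i; apply: convex_hull_separation => u m um.
apply: (closed_trajectory_dot_le a t t m u y (trajectory_closed _ _ _ _ ty tb) ny).
  by move=> k; apply: (dot_convex_hull_le _ u m _ _ (Hy k)) => _ [j _ <-].
by rewrite at_ lexx.
Qed.

(** A bound for all the coordinates of a state. *)
Definition coord_bound x : R := \sum_i \sum_k `|x i 0 k|.

Lemma coord_bound_ge0 x : 0 <= coord_bound x.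
Proof. by apply: sumr_ge0 => i _; apply: sumr_ge0. Qed.

Lemma coord_boundP x i k : `|x i 0 k| <= coord_bound x.
Proof.
rewrite /coord_bound (bigD1 i)//= (bigD1 k)//= -addrA lerDl addr_ge0//.
  exact: sumr_ge0.
by apply: sumr_ge0 => j _; exact: sumr_ge0.
Qed.

Lemma dot_delta (k : 'I_d) (v : 'rV[R]_d) : dot (delta_mx 0 k) v = v 0 k.
Proof.
rewrite /dot (bigD1 k)//= mxE !eqxx mul1r big1 ?addr0// => j jk.
by rewrite mxE (negbTE jk) andbF mul0r.
Qed.

Lemma closed_trajectory_coord_le (a b t : R) y : closed_trajectory a b y ->
  nonvanishing (y a) -> a <= t <= b ->
  forall i k, `|y t i 0 k| <= coord_bound (y a).
Proof.
move=> ty ny tab i k.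
have H (e : R) : `|e| <= 1 -> e * y t i 0 k <= coord_bound (y a).
  move=> e1; rewrite -dot_delta -dotZr dotC -[delta_mx 0 k]scale1r.
  have -> : dot (e *: y t i) (1 *: delta_mx 0 k) = dot (e *: delta_mx 0 k) (y t i).
    by rewrite scale1r dotC dotZr [RHS]dotC dotZr dotC.
  apply: (closed_trajectory_dot_le a b t _ _ y ty ny) => // j.
  rewrite dotC dotZr dotC dot_delta.
  apply: le_trans (ler_norm _) _; rewrite normrM.
  by apply: le_trans (coord_boundP (y a) j k); rewrite ler_piMl.
have H1 := H 1; have H2 := H (-1).
rewrite normr1 mul1r in H1; rewrite normrN1 mulN1r in H2.
by rewrite ler_norml H1// andbT lerNl H2.
Qed.

(** The state with coordinates [u], clamped to [- B, B]. *)
Definition clamped_state (B : R) (u : 'I_n * 'I_d -> R) : state R n d :=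
  fun i => \row_k clamp B (u (i, k)).

(** The family of the coordinates of a state. *)
Definition state_coords x : 'I_n * 'I_d -> R := fun p => x p.1 0 p.2.

Lemma clamped_stateK (B : R) x : (forall i k, `|x i 0 k| <= B) ->
  clamped_state B (state_coords x) = x.
Proof.
move=> xB; apply/funext => i; apply/rowP => k.
rewrite mxE /state_coords/= clamp_id//; exact: xB.
Qed.

(** The contribution of agent [j] to the coordinate [p] of the regularized field,
    in which norms are truncated at [r] and coordinates clamped to [- B, B]. *)
Definition trunc_term (r B : R) (p : 'I_n * 'I_d) (j : 'I_n)
    (u : 'I_n * 'I_d -> R) : R :=
  trunc_weight f r (clamped_state B u) p.1 j *
  (clamp B (u (j, p.2)) - clamp B (u (p.1, p.2))).

Lemma switched_trunc_rhs (r B t : R) u p :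
  switched_field (fun p j t => j \in N p.1 t) (trunc_term r B) t u p =
  trunc_rhs f N r t (clamped_state B u) p.1 0 p.2.
Proof.
rewrite /switched_field /trunc_rhs summxE big_mkcond.
rewrite [RHS]big_mkcond; apply: eq_bigr => j _.
by case: ifP => _; rewrite ?mul0r// mul1r !mxE.
Qed.

Lemma trunc_term_bounded_lipschitz (r B : R) p j : 0 < r -> 0 <= B ->
  bounded_lipschitz (trunc_term r B p j).
Proof.
move=> r0 B0.
have bc q : bounded_lipschitz (fun u : 'I_n * 'I_d -> R => clamp B (u q)).
  exact: bounded_lipschitz_clamp.
have be i : bounded_lipschitz (fun u => trunc_enorm r (clamped_state B u i)).
  apply: bounded_lipschitz_max; apply: bounded_lipschitz_enorm => k.
  by under eq_fun do rewrite mxE; exact: bc.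
have bV i : bounded_lipschitz (fun u => (trunc_enorm r (clamped_state B u i))^-1).
  apply: (bounded_lipschitzV r) => // u.
  by rewrite le_max lexx orbT.
have bd i k : bounded_lipschitz (fun u => trunc_direction r (clamped_state B u i) 0 k).
  under eq_fun do rewrite 2!mxE.
  exact: bounded_lipschitzM.
apply: bounded_lipschitzM; last exact: bounded_lipschitzB.
apply: bounded_lipschitzM; last exact: bounded_lipschitzM.
apply: bounded_lipschitz_comp.
  apply: bounded_lipschitz_enorm => k.
  under eq_fun do rewrite mxE [X in _ + X]mxE.
  exact: bounded_lipschitzB.
by have [K K0 HK] := lipschitz_dist _ (f_lip p.1 j); exists K => //; exact: ltW.
Qed.

Lemma trunc_rhs_lipschitz (r B : R) : 0 < r -> 0 <= B ->
  exists2 L, 0 <= L & forall t u v e, (forall p, `|u p - v p| <= e) ->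
    forall i k, `|trunc_rhs f N r t (clamped_state B u) i 0 k -
                  trunc_rhs f N r t (clamped_state B v) i 0 k| <= L * e.
Proof.
move=> r0 B0.
have /choice[L HL] : forall q : ('I_n * 'I_d) * 'I_n, exists L : R, 0 <= L /\
    forall u v e, (forall p, `|u p - v p| <= e) ->
      `|trunc_term r B q.1 q.2 u - trunc_term r B q.1 q.2 v| <= L * e.
  move=> [p j]; have [C [L [L0 _ H]]] := trunc_term_bounded_lipschitz r B p j r0 B0.
  by exists L.
have L0 q : 0 <= L q by have [] := HL q.
exists (\sum_p \sum_j L (p, j)).
  by apply: sumr_ge0 => p _; exact: sumr_ge0.
move=> t u v e uv i k; have e0 : 0 <= e := le_trans (normr_ge0 _) (uv (i, k)).
rewrite -!(switched_trunc_rhs r B t _ (i, k)) /switched_field -sumrB.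
apply: (@le_trans _ _ ((\sum_j L ((i, k), j)) * e)); last first.
  rewrite ler_wpM2r// [leRHS](bigD1 (i, k))//= lerDl.
  by apply: sumr_ge0 => p _; exact: sumr_ge0.
rewrite mulr_suml; apply: (le_trans (ler_norm_sum _ _ _)).
apply: ler_sum => j _; rewrite -mulrBr normrM.
have [_ H] := HL ((i, k), j); apply: le_trans (H u v e uv).
by case: (_ \in _); rewrite ?normr1 ?mul1r// normr0 mul0r.
Qed.

(** Two trajectories from the same state lie in a region where the field equals
    the regularized one; the maximum principle is applied to the differences of
    their coordinates, with both signs. *)
Lemma closed_trajectory_unique (a b : R) y z : closed_trajectory a b y ->
  closed_trajectory a b z -> nonvanishing (y a) -> y a = z a ->
  forall t, a <= t <= b -> y t = z t.
Proof.
move=> ty tz ny yz.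
have nz : nonvanishing (z a) by rewrite -yz.
have [r r0 rP] := closed_trajectory_lower a b _ ny.
pose B := coord_bound (y a).
have [L L0 LP] := trunc_rhs_lipschitz r B r0 (coord_bound_ge0 _).
have rhsE w t : closed_trajectory a b w -> w a = y a -> a <= t <= b ->
    rhs f N t (w t) = trunc_rhs f N r t (clamped_state B (state_coords (w t))).
  move=> tw wy tab; rewrite clamped_stateK; last first.
    move=> i k; rewrite /B -wy.
    by apply: (closed_trajectory_coord_le a b t w tw) => //; rewrite wy.
  by apply/funext => i; rewrite trunc_rhsE// => j; exact: rP.
(* the boolean is the sign *)
pose g (q : ('I_n * 'I_d) * bool) t : R :=
  (-1) ^+ q.2 * (y t q.1.1 0 q.1.2 - z t q.1.1 0 q.1.2).
have g_le q t : a <= t <= b -> g q t <= 0.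
  move=> tab; apply: (max_principle g (switching_time N) a b L 1) => //.
  - move=> k s; apply: cvgM; first exact: cvg_cst.
    by apply: cvgB; apply: within_continuous_coord; [have [] := ty|have [] := tz].
  - exact: switching_right.
  - by move=> k; rewrite /g yz subrr mulr0.
  move=> [[i k] e] s sab nS gmax /andP[g0 _].
  have sab' : a <= s <= b by have /andP[/ltW -> ->] := sab.
  have dy := ty.2 s sab nS (closed_trajectory_nonvanishing a b s y ty ny sab') i.
  have dz := tz.2 s sab nS (closed_trajectory_nonvanishing a b s z tz nz sab') i.
  have dg := is_deriveZ ((-1) ^+ e)
    (is_deriveB (is_derive_coord _ _ _ k dy) (is_derive_coord _ _ _ k dz)).
  rewrite (rhsE y s ty (erefl _) sab') (rhsE z s tz (esym yz) sab') in dg.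
  eexists; first exact: dg.
  apply: (le_trans (ler_norm _)).
  rewrite normrM normrX normrN1 expr1n mul1r; apply: LP => -[j l].
  (* at the maximum, all coordinates of the difference are at most [g] *)
  rewrite /state_coords/= ler_norml.
  have := gmax ((j, l), false); have := gmax ((j, l), true).
  rewrite {1 3}/g/= expr0 expr1 mul1r mulN1r => h1 h2.
  by apply/andP; split => //; rewrite lerNl.
move=> t tab; apply/funext => i; apply/rowP => k.
have := g_le ((i, k), false) t tab; have := g_le ((i, k), true) t tab.
rewrite /g/= expr0 expr1 mul1r mulN1r => *; lra.
Qed.

End Trajectories.

(** * Existence *)

(** The set is the union of its interior and of a set of discontinuity times of
    [g], of which there are countably many. *)
Lemma measurable_piecewise_constant {R : realType} {n : nat} (g : R -> {set 'I_n}) j :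
  piecewise_constant g -> measurable [set t : R | j \in g t].
Proof.
move=> gpc; set A := [set t | _].
have -> : A = A° `|` (A `&` discontinuity_time g).
  apply/seteqP; split=> t; last by move=> [/interior_subset|[]].
  move=> At; have [Dt|] := pselect (discontinuity_time g t); first by right.
  move=> /contrapT gt; left; apply: filterS gt => s gs.
  by rewrite /A /= gs.
apply: measurableU; first by apply: open_measurable; exact: open_interior.
apply: countable_measurable => //.
apply: (@sub_countable _ _ _ (\bigcup_(k in [set: nat])
  (discontinuity_time g `&` `[- k%:R, k%:R]))).
  apply: subset_card_le => t [_ Dt]; exists (Num.bound `|t|) => //; split=> //=.
  have := archi_boundP (normr_ge0 t); rewrite in_itv/= ltr_norml.
  by move=> /andP[/ltW -> /ltW ->].
apply: bigcup_countable => //.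
by move=> k _; exact: finite_set_countable.
Qed.

Section Existence.
Context {R : realType} {n d : nat}.
Variables (f : 'I_n -> 'I_n -> R -> R) (N : 'I_n -> R -> {set 'I_n}).
Hypothesis f_lip : forall i j, lipschitz (f i j).
Hypothesis f_pos : forall i j (x : R), 0 < x -> 0 < f i j x.
Hypothesis N_pc : forall i, piecewise_constant (N i).
Hypothesis N_rc : forall i, right_continuous_signal (N i).
Implicit Types (y z : R -> state R n d) (x : state R n d).

Lemma closed_trajectoryS (a b c : R) y : c <= b ->
  closed_trajectory f N a b y -> closed_trajectory f N a c y.
Proof.
move=> cb [cy dy]; split=> [i|t /andP[at_ tc]].
  apply: continuous_subspaceW (cy i) => t /=.
  by rewrite !in_itv/= => /andP[-> tc]; rewrite (le_trans tc).
by apply: dy; rewrite at_ (le_trans tc).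
Qed.

(** An integral curve of the regularized field. *)
Lemma regularized_solution (r B : R) x : 0 < r -> 0 <= B ->
  exists X : R -> 'I_n * 'I_d -> R,
  [/\ forall p t, t <= 0 -> X t p = state_coords x p,
      forall p, continuous (fun t => X t p) &
      forall p t, 0 < t -> ~ switching_time N t ->
        is_derive t (1 : R) (fun s => X s p)
          (switched_field (fun p j t => j \in N p.1 t) (trunc_term f r B) t (X t) p)].
Proof.
move=> r0 B0; apply: switched_picard.
- by move=> p j; exact: measurable_piecewise_constant.
- move=> p j t nS.
  have : \forall s \near t, N p.1 s = N p.1 t.
    by apply: contrapT => nN; apply: nS; exists p.1.
  by apply: filterS => s ->.
- by move=> p j; exact: trunc_term_bounded_lipschitz.
Qed.

(** The clamped field does not point out of the box, so its integral curves stay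
    in it, where the clamping has no effect. *)
Lemma regularized_solution_le (r B T : R) (X : R -> 'I_n * 'I_d -> R) :
  (forall p, `|X 0 p| <= B) -> (forall p, continuous (fun t => X t p)) ->
  (forall p t, 0 < t -> ~ switching_time N t ->
     is_derive t (1 : R) (fun s => X s p)
       (switched_field (fun p j t => j \in N p.1 t) (trunc_term f r B) t (X t) p)) ->
  forall p t, 0 <= t <= T -> `|X t p| <= B.
Proof.
move=> X0 cX dX p t tT.
pose g (q : ('I_n * 'I_d) * bool) s : R := (-1) ^+ q.2 * X s q.1 - B.
have g_le q : g q t <= 0.
  apply: (max_principle g (switching_time N) 0 T 0 1) => //.
  - move=> k; apply: continuous_subspaceT => s; apply: cvgB; last exact: cvg_cst.
    by apply: cvgM; [exact: cvg_cst | exact: cX].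
  - exact: switching_right.
  - move=> k; rewrite /g subr_le0; apply: le_trans (ler_norm _) _.
    by rewrite normrM normrX normrN1 expr1n mul1r.
  move=> [[i k] e] s /andP[s0 _] nS gmax _; rewrite mul0r.
  have dg := is_deriveB (is_deriveZ ((-1) ^+ e) (dX (i, k) s s0 nS))
    (is_derive_cst B s 1).
  eexists; first exact: dg.
  rewrite subr0 /GRing.scale/= /switched_field mulr_sumr; apply: sumr_le0 => j _.
  rewrite mulrCA mulr_ge0_le0// /trunc_term mulrCA.
  rewrite mulr_ge0_le0 ?trunc_weight_ge0//=.
  have := gmax ((j, k), e); rewrite /g /= lerD2r.
  case: e {gmax dg} => /=; rewrite ?expr0 ?expr1 ?mul1r ?mulN1r.
    by rewrite lerN2 oppr_le0 subr_ge0; exact: clamp_le.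
  by rewrite subr_le0; exact: clamp_le.
have := g_le (p, false); have := g_le (p, true).
rewrite /g/= expr0 expr1 mul1r mulN1r ler_norml => *; apply/andP; split; lra.
Qed.

Lemma exists_closed_trajectory (T : R) x : 0 <= T -> nonvanishing x ->
  exists y, [/\ forall t, t <= 0 -> y t = x,
    forall i, continuous (fun t => y t i) & closed_trajectory f N 0 T y].
Proof.
move=> T0 nx; have [rho rho0 rhoP] := enorm_pos_lower x nx.
have [F F0 fF] := bounded_weights f f_lip.
set m := rho ^+ 2 * expR (- (4 * n%:R * F) * (T - 0)).
have m0 : 0 < m by rewrite mulr_gt0 ?expR_gt0 ?exprn_gt0.
have [r r0 rm] := small_sqr m m0.
pose B := coord_bound x.
have [X [X0 cX dX]] := regularized_solution r B x r0 (coord_bound_ge0 x).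
have XB : forall p t, 0 <= t <= T -> `|X t p| <= B.
  apply: regularized_solution_le => // p.
  by rewrite X0//; exact: coord_boundP.
pose y t : state R n d := fun i => \row_k X t (i, k).
have y0 t : t <= 0 -> y t = x.
  by move=> t0; apply/funext => i; apply/rowP => k; rewrite mxE X0.
have cy i : continuous (fun t => y t i).
  by apply: continuous_rV => k; under eq_fun do rewrite mxE; exact: cX.
have dy t : 0 < t <= T -> ~ switching_time N t -> forall i,
    is_derive t (1 : R) (fun s => y s i) (trunc_rhs f N r t (y t) i).
  move=> /andP[t0 tT] nS i; apply: is_derive_rV => k.
  have := dX (i, k) t t0 nS; rewrite switched_trunc_rhs.
  have -> : clamped_state B (X t) = y t.
    apply/funext => j; apply/rowP => l; rewrite !mxE clamp_id// XB//.
    by rewrite (ltW t0).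
  move=> dXi; have E : (fun s => X s (i, k)) = (fun s => y s i 0 k).
    by apply/funext => s; rewrite mxE.
  by rewrite -E.
have cy' i : {within `[0, T], continuous (fun t => y t i)}.
  exact: continuous_subspaceT.
exists y; split=> //; split=> // t tT nS ny i.
rewrite -(trunc_rhsE f N r); first exact: dy.
move=> j; rewrite -(@ler_pXn2r _ 2) ?nnegrE ?enorm_ge0 ?(ltW r0)//.
have tT' : 0 <= t <= T by have /andP[/ltW -> ->] := tT.
have ya k : rho <= enorm (y 0 k) by rewrite y0.
have dy' s : 0 < s <= T -> ~ switching_time N s -> nonvanishing (y s) ->
    (forall k, r <= enorm (y s k)) ->
    forall k, is_derive s (1 : R) (fun u => y u k) (trunc_rhs f N r s (y s) k).
  by move=> sT nSs _ _; exact: dy.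
have H := enorm_lower_bound f N f_lip f_pos N_rc F r rho 0 T y F0 fF (ltW r0)
  (ltW rho0) cy' dy' ya rm j t tT'.
apply: le_trans (ltW rm) _; apply: le_trans H.
rewrite ler_wpM2l ?sqr_ge0// ler_expR ler_wnM2l ?oppr_le0 ?mulr_ge0//.
by have /andP[_ tT2] := tT; rewrite lerB.
Qed.

(** The solutions on the intervals [0, m + 1] agree where they overlap. *)
Lemma exists_global_solution x : nonvanishing x ->
  exists2 z, solution f N 0 +oo%E z & z 0 = x.
Proof.
move=> nx.
have /choice[Y HY] : forall m : nat, exists y, [/\ forall t, t <= 0 -> y t = x,
    forall i, continuous (fun t => y t i) &
    closed_trajectory f N 0 m.+1%:R y].
  by move=> m; exact: exists_closed_trajectory.
have Y0 m t : t <= 0 -> Y m t = x by have [H _ _] := HY m; exact: H.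
have YE m m' (t : R) : t <= m.+1%:R -> t <= m'.+1%:R -> Y m t = Y m' t.
  move=> tm tm'; have [t0|t0] := leP t 0; first by rewrite !Y0.
  have [_ _ ty] := HY m; have [_ _ ty'] := HY m'.
  apply: (closed_trajectory_unique f N f_lip f_pos N_rc 0 t _ _
    (closed_trajectoryS _ _ _ _ tm ty) (closed_trajectoryS _ _ _ _ tm' ty')).
  - by rewrite Y0.
  - by rewrite !Y0.
  - by rewrite (ltW t0) lexx.
(* [t] is below the horizon of the solution number [truncn t] *)
pose z t := Y (Num.truncn t) t.
have zE m (t : R) : t <= m.+1%:R -> z t = Y m t.
  by move=> tm; apply: YE => //; exact/ltW/truncnS_gt.
have z_near (t : R) : \forall s \near t, z s = Y (Num.truncn t) s.
  have : \forall s \near t, s < (Num.truncn t).+1%:R by apply: lt_nbhsl; exact: truncnS_gt.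
  by apply: filterS => s st; apply: zE; exact: ltW.
have cz i : continuous (fun t => z t i).
  move=> t; have [_ cY _] := HY (Num.truncn t).
  rewrite /continuous_at [z t]/z; apply: cvg_trans (cY i t).
  by apply: near_eq_cvg; apply: filterS (z_near t) => s ->.
have tz b : closed_trajectory f N 0 b z.
  split=> [i|t /andP[t0 tb] nS nz i]; first exact: continuous_subspaceT.
  have [_ _ [_ dY]] := HY (Num.truncn t).
  have := dY t _ nS nz i; rewrite t0 ltW ?truncnS_gt// => /(_ isT).
  by apply: near_eq_is_derive; apply: filterS (z_near t) => s ->.
have z0 : z 0 = x by rewrite /z Y0.
exists z => //; split; last first.
  move=> t [t0 _]; apply: (closed_trajectory_nonvanishing f N f_lip f_pos N_rc 0 t t z) => //.
    by rewrite z0.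
  by rewrite t0 lexx.
split=> [i|t t0 _ nS nz i]; first exact: continuous_subspaceT.
by apply: (tz t).2 => //; rewrite t0 lexx.
Qed.

End Existence.

Theorem proposition4 (R : realType) (n d : nat) (hd : (2 <= d)%N)
    (f : 'I_n -> 'I_n -> R -> R)
    (f_lip : forall i j, lipschitz (f i j))
    (f_pos : forall i j (x : R), 0 < x -> 0 < f i j x)
    (N : 'I_n -> R -> {set 'I_n})
    (N_pc : forall i, piecewise_constant (N i))
    (N_rc : forall i, right_continuous_signal (N i))
    (tauD : R) (tauD_gt0 : 0 < tauD)
    (N_dwell : forall i, dwell_time_gt (N i) tauD)
    (N_conn : uniformly_quasi_strongly_connected N)
    (z0 : state R n d) (z0_neq0 : forall i, z0 i != 0) :
  [/\ exists z : R -> state R n d,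
        [/\ solution f N 0 +oo%E z, z 0 = z0 &
            forall (b : \bar R) (y : R -> state R n d),
              solution f N 0 b y -> y 0 = z0 ->
              forall t, time_interval 0 b t -> y t = z t],
      forall (tf : \bar R) (z : R -> state R n d),
        solution f N 0 tf z -> z 0 = z0 ->
        forall t, time_interval 0 tf t ->
          forward_invariant f N
            (cartesian_power (convex_hull [set z t i | i in [set: 'I_n]])) &
      forward_invariant f N (cartesian_power (~` [set (0 : 'rV[R]_d)]))].
Proof.
split.
- have [z sz z_0] := exists_global_solution f N f_lip f_pos N_pc N_rc z0 z0_neq0.
  exists z; split=> // b y [ty _] y_0 t [t0 tb].
  have tz := trajectory_closed f N 0 t +oo%E z sz.1 (ltry t).
  apply: (closed_trajectory_unique f N f_lip f_pos N_rc 0 t y z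
    (trajectory_closed f N _ _ _ _ ty tb) tz).
  - by rewrite y_0.
  - by rewrite y_0 z_0.
  - by rewrite t0 lexx.
- by move=> tf z _ _ t _; exact: forward_invariant_convex_hull.
- exact: forward_invariant_nonvanishing.
Qed.
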